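(* Consider the sensor-network hypothesis testing model and the Decentralized Chernoff Test (DCT) described in the context, with observation cost per unit time $c\in(0,1)$. Then: (i) For all $c\in(0,1)$ and all $i\in[M]$, $\mathbb{P}^{\mathcal{C}}_i(\hat H\neq h_i)\le \min\{(M-1)c,\,1\}$. (ii) For all $i\in[M]$, $\mathbb{E}^{\mathcal{C}}_i[N]\le (1+o(1))\,\frac{|\log c|}{I(i)}$ as $c\to 0$. (iii) For all $i\in[M]$, the risk satisfies $\mathbb{R}^{\mathcal{C}}_i\le (1+o(1))\,\frac{c\,|\log c|}{I(i)}$ as $c\to0$. (iv) Let $r\ge 2$. If for all $\ell\in[L]$ and $i,j,k_1\in[M]$ one has $\mathbb{E}\big[\big(\log \frac{p^{u_{k_1}}_{i,\ell}(Y)}{p^{u_{k_1}}_{j,\ell}(Y)}\big)^r\big]<\infty$, then for all $i\in[M]$, $\mathbb{E}^{\mathcal{C}}_i[N^r]\le \Big((1+o(1))\frac{|\log c|}{I(i)}\Big)^r$ as $c\to0$.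
   Context: Model: there are $L$ sensors and $M$ mutually exclusive, exhaustive hypotheses $h_1,\dots,h_M$; $[M]=\{1,\dots,M\}$; $H^*$ denotes the true hypothesis. At every time step each sensor $\ell$ chooses a probing action from $S=\{u_1,\dots,u_M\}$; if the true hypothesis is $h_i$ and sensor $\ell$ uses action $u$, the observation it receives has density $p^{u}_{i,\ell}$. Given $H^*$, observations at different sensors are independent, and at each sensor a new observation given the action is drawn independently of the past; actions may depend causally on past observations. Standing assumptions: for all $\ell,i,j,k_1$, $D(p^{u_{k_1}}_{i,\ell}\|p^{u_{k_1}}_{j,\ell})<\infty$; for all $\ell$ and $i\ne j$ there is an action $u_{k_1}$ with $D(p^{u_{k_1}}_{i,\ell}\|p^{u_{k_1}}_{j,\ell})>0$; and the second moment of $\log\big(p^{u_{k_1}}_{i,\ell}(Y)/p^{u_{k_1}}_{j,\ell}(Y)\big)$ is finite. Here $D(\cdot\|\cdot)$ is the Kullback–Leibler divergence. Let $\mathcal Q$ be the set of probability mass functions on $S$. Define $v_{i,\ell}=\max_{q\in\mathcal Q}\min_{j\ne i}\sum_{u}q(u)D(p^u_{i,\ell}\|p^u_{j,\ell})$, $I(i)=\sum_{\ell=1}^L v_{i,\ell}$, and $\rho_{i,\ell}=v_{i,\ell}/I(i)$. DCT (decentralized setup: sensors communicate only with a fusion center). Initialization: each sensor $\ell$ sends $(v_{1,\ell},\dots,v_{M,\ell})$ to the fusion center, which sends back $(\rho_{1,\ell},\dots,\rho_{M,\ell})$. Test phase: each sensor independently runs a Chernoff test: at step $k$, with $y^{k-1}_\ell,u^{k-1}_\ell$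 its own past observations and actions, it forms $i^*_{k-1}=\arg\max_i \mathbb{P}(H^*=h_i\mid y^{k-1}_\ell,u^{k-1}_\ell)$ and draws $u_{k,\ell}$ at random according to $Q^\ell_{i^*_{k-1}}=\arg\max_{q\in\mathcal Q}\min_{j\ne i^*_{k-1}}\sum_u q(u)D(p^u_{i^*_{k-1},\ell}\|p^u_{j,\ell})$, then updates the posteriors $p_{i,\ell}(y^k_\ell,u^k_\ell)=\mathbb{P}(H^*=h_i\mid y^k_\ell,u^k_\ell)$. Whenever at time $n$ sensor $\ell$ has $\log\frac{p_{i^*_n,\ell}(y^n_\ell,u^n_\ell)}{\max_{j\ne i^*_n}p_{j,\ell}(y^n_\ell,u^n_\ell)}\ge \rho_{i^*_n,\ell}|\log c|$, it communicates the local decision $h_{i^*_n}$ to the fusion center but keeps running. The fusion center makes the final decision $\hat H=h_i$ at the first time at which the local decisions of all sensors are in favor of $h_i$, and then sends a halting message to all sensors. $N$ is the time at which the final decision is made. $\mathbb{P}^{\mathcal{C}}_i,\mathbb{E}^{\mathcal{C}}_i$ denote probability and expectation under DCT when $h_i$ is true. The risk of a test $\delta$ under $h_i$ is $\mathbb{R}^\delta_i=c\,\mathbb{E}^\delta_i[N]+\omega_i\mathbb{P}^\delta_i(\hat H\ne h_i)$, with $\omega_i>0$ a fixed cost of wrong decision. *)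

(* Defs.v *)
From HB Require Import structures.
From mathcomp Require Import all_boot all_order all_algebra.
From mathcomp Require Import all_classical all_reals all_analysis.
Set Implicit Arguments. Unset Strict Implicit. Unset Printing Implicit Defensive.
Import Order.TTheory GRing.Theory Num.Theory.
Import numFieldNormedType.Exports.
Local Open Scope classical_set_scope.
Local Open Scope ring_scope.

(* Model data.  Sensors are indexed by 'I_L, hypotheses h_1..h_M by 'I_M,
   probing actions u_1..u_M by 'I_M.  Observations take values in a
   measurable space Yt and have densities f l u i (sensor l, action u,
   true hypothesis i) with respect to a reference measure mu.           *)

Definition is_density {R : realType} {d} {T : measurableType d}
  (mu : {measure set T -> \bar R}) (p : T -> R) : Prop :=
  [/\ measurable_fun setT p, (forall y, 0 <= p y) & (\int[mu]_y (p y)%:E = 1)%E].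

Definition KL {R : realType} {d} {T : measurableType d}
  (mu : {measure set T -> \bar R}) (p q : T -> R) : \bar R :=
  if pselect {ae mu, forall y, q y = 0 -> p y = 0} is left _ then
    (\int[mu]_y (p y * ln (p y / q y))%:E)%E
  else (+oo)%E.

Definition is_pmf {R : realType} {M : nat} (q : 'I_M -> R) : Prop :=
  (forall u, 0 <= q u) /\ \sum_u q u = 1.

(* real value of D(p^u_{i,l} || p^u_{j,l}) (finite under the assumptions) *)
Definition Dr {R : realType} {d} {T : measurableType d} {L M : nat}
  (mu : {measure set T -> \bar R}) (f : 'I_L -> 'I_M -> 'I_M -> T -> R)
  (l : 'I_L) (u i j : 'I_M) : R :=
  fine (KL mu (f l u i) (f l u j)).

Definition Jobj {R : realType} {d} {T : measurableType d} {L M : nat}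
  (mu : {measure set T -> \bar R}) (f : 'I_L -> 'I_M -> 'I_M -> T -> R)
  (l : 'I_L) (i : 'I_M) (q : 'I_M -> R) : R :=
  inf [set (\sum_u q u * Dr mu f l u i j) | j in [set j : 'I_M | j != i]].

Definition vval {R : realType} {d} {T : measurableType d} {L M : nat}
  (mu : {measure set T -> \bar R}) (f : 'I_L -> 'I_M -> 'I_M -> T -> R)
  (l : 'I_L) (i : 'I_M) : R :=
  sup [set Jobj mu f l i q | q in [set q : 'I_M -> R | is_pmf q]].

Definition Iinfo {R : realType} {d} {T : measurableType d} {L M : nat}
  (mu : {measure set T -> \bar R}) (f : 'I_L -> 'I_M -> 'I_M -> T -> R)
  (i : 'I_M) : R :=
  \sum_(l < L) vval mu f l i.

Definition rho {R : realType} {d} {T : measurableType d} {L M : nat}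
  (mu : {measure set T -> \bar R}) (f : 'I_L -> 'I_M -> 'I_M -> T -> R)
  (l : 'I_L) (i : 'I_M) : R :=
  vval mu f l i / Iinfo mu f i.

(* Probabilistic skeleton: under hypothesis i, Y k l u is the observation
   sensor l would receive at time k+1 if it used action u, and U k l is a
   uniform [0,1] variable used by sensor l to randomize its action at time
   k+1; all of them mutually independent.                               *)

Definition indep_skeleton {R : realType} {dO} {Om : measurableType dO}
  {dY} {Yt : measurableType dY} {L M : nat} (P : probability Om R)
  (Y : nat -> 'I_L -> 'I_M -> Om -> Yt) (U : nat -> 'I_L -> Om -> R) : Prop :=
  forall (s : seq (nat * 'I_L * 'I_M)) (t : seq (nat * 'I_L))
    (A : nat * 'I_L * 'I_M -> set Yt) (B : nat * 'I_L -> set R),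
    uniq s -> uniq t -> (forall x, measurable (A x)) -> (forall y, measurable (B y)) ->
    P (\big[setI/setT]_(x <- s) (Y x.1.1 x.1.2 x.2 @^-1` A x)
       `&` \big[setI/setT]_(y <- t) (U y.1 y.2 @^-1` B y))
    = (\prod_(x <- s) P (Y x.1.1 x.1.2 x.2 @^-1` A x)
       * \prod_(y <- t) P (U y.1 y.2 @^-1` B y))%E.

Definition skeleton {R : realType} {dO} {Om : measurableType dO}
  {dY} {Yt : measurableType dY} {L M : nat} (P : probability Om R)
  (mu : {measure set Yt -> \bar R}) (fi : 'I_L -> 'I_M -> Yt -> R)
  (Y : nat -> 'I_L -> 'I_M -> Om -> Yt) (U : nat -> 'I_L -> Om -> R) : Prop :=
  [/\ (forall k l u, measurable_fun setT (Y k l u)),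
      (forall k l, measurable_fun setT (U k l)),
      (forall k l u (A : set Yt), measurable A ->
          P (Y k l u @^-1` A) = (\int[mu]_(y in A) (fi l u y)%:E)%E),
      (forall k l (B : set R), measurable B ->
          P (U k l @^-1` B) = lebesgue_measure (B `&` [set x : R | 0 <= x <= 1]))
    & indep_skeleton P Y U].

Definition lik {R : realType} {dY} {Yt : measurableType dY} {L M : nat}
  (f : 'I_L -> 'I_M -> 'I_M -> Yt -> R) (l : 'I_L) (h : seq ('I_M * Yt))
  (j : 'I_M) : R :=
  \prod_(p <- h) f l p.1 j p.2.

(* posterior P(H* = h_j | y^n_l, u^n_l) under the uniform prior (the action
   randomization probabilities do not depend on the hypothesis and cancel) *)
Definition post {R : realType} {dY} {Yt : measurableType dY} {L M : nat}
  (f : 'I_L -> 'I_M -> 'I_M -> Yt -> R) (l : 'I_L) (h : seq ('I_M * Yt))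
  (j : 'I_M) : R :=
  lik f l h j / \sum_m lik f l h m.

(* an argmax (ties broken towards the smallest index; d0 is never used
   since 'I_M is finite and non-empty) *)
Definition argmaxI {R : realType} {M : nat} (d0 : 'I_M) (F : 'I_M -> R) : 'I_M :=
  odflt d0 [pick j | [forall m, F m <= F j]].

Definition istar {R : realType} {dY} {Yt : measurableType dY} {L M : nat}
  (d0 : 'I_M) (f : 'I_L -> 'I_M -> 'I_M -> Yt -> R) (l : 'I_L)
  (h : seq ('I_M * Yt)) : 'I_M :=
  argmaxI d0 (post f l h).

(* draw an action according to the pmf q, using a uniform [0,1] sample x
   (inverse-cdf sampling) *)
Definition sample {R : realType} {M : nat} (d0 : 'I_M) (q : 'I_M -> R) (x : R) : 'I_M :=
  odflt d0 [pick a : 'I_M | x < \sum_(b : 'I_M | (nat_of_ord b <= nat_of_ord a)%N) q b].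

Fixpoint hist {R : realType} {dO} {Om : measurableType dO} {dY} {Yt : measurableType dY}
  {L M : nat} (d0 : 'I_M) (f : 'I_L -> 'I_M -> 'I_M -> Yt -> R)
  (Q : 'I_L -> 'I_M -> 'I_M -> R)
  (Y : nat -> 'I_L -> 'I_M -> Om -> Yt) (U : nat -> 'I_L -> Om -> R)
  (l : 'I_L) (w : Om) (n : nat) : seq ('I_M * Yt) :=
  match n with
  | 0 => [::]
  | n'.+1 =>
      let h := hist d0 f Q Y U l w n' in
      let u := sample d0 (Q l (istar d0 f l h)) (U n' l w) in
      rcons h (u, Y n' l u w)
  end.

(* local threshold condition:
   log( p_{i*}(n) / max_{j<>i*} p_j(n) ) >= rho_{i*,l} |log c|,
   written multiplicatively (so that a zero denominator means +oo) *)
Definition local_ok {R : realType} {dY} {Yt : measurableType dY} {L M : nat}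
  (d0 : 'I_M) (f : 'I_L -> 'I_M -> 'I_M -> Yt -> R) (rh : 'I_L -> 'I_M -> R)
  (c : R) (l : 'I_L) (h : seq ('I_M * Yt)) : bool :=
  let i := istar d0 f l h in
  expR (rh l i * `|ln c|) * \big[Num.max/0]_(j | j != i) post f l h j
    <= post f l h i.

Fixpoint last_dec {R : realType} {dO} {Om : measurableType dO} {dY} {Yt : measurableType dY}
  {L M : nat} (d0 : 'I_M) (f : 'I_L -> 'I_M -> 'I_M -> Yt -> R)
  (Q : 'I_L -> 'I_M -> 'I_M -> R) (rh : 'I_L -> 'I_M -> R) (c : R)
  (Y : nat -> 'I_L -> 'I_M -> Om -> Yt) (U : nat -> 'I_L -> Om -> R)
  (l : 'I_L) (w : Om) (n : nat) : option 'I_M :=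
  match n with
  | 0 => None
  | n'.+1 =>
      let h := hist d0 f Q Y U l w n'.+1 in
      if local_ok d0 f rh c l h then Some (istar d0 f l h)
      else last_dec d0 f Q rh c Y U l w n'
  end.

Definition stopped {R : realType} {dO} {Om : measurableType dO} {dY} {Yt : measurableType dY}
  {L M : nat} (d0 : 'I_M) (f : 'I_L -> 'I_M -> 'I_M -> Yt -> R)
  (Q : 'I_L -> 'I_M -> 'I_M -> R) (rh : 'I_L -> 'I_M -> R) (c : R)
  (Y : nat -> 'I_L -> 'I_M -> Om -> Yt) (U : nat -> 'I_L -> Om -> R)
  (w : Om) (n : nat) : bool :=
  [exists i : 'I_M, [forall l : 'I_L, last_dec d0 f Q rh c Y U l w n == Some i]].

Definition Nstop {R : realType} {dO} {Om : measurableType dO} {dY} {Yt : measurableType dY}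
  {L M : nat} (d0 : 'I_M) (f : 'I_L -> 'I_M -> 'I_M -> Yt -> R)
  (Q : 'I_L -> 'I_M -> 'I_M -> R) (rh : 'I_L -> 'I_M -> R) (c : R)
  (Y : nat -> 'I_L -> 'I_M -> Om -> Yt) (U : nat -> 'I_L -> Om -> R)
  (w : Om) : option nat :=
  match pselect (exists n, stopped d0 f Q rh c Y U w n) with
  | left h => Some (ex_minn h)
  | right _ => None
  end.

Definition NE {R : realType} (N : option nat) : \bar R :=
  if N is Some n then (n%:R)%:E else (+oo)%E.

Definition NEpow {R : realType} (r : R) (N : option nat) : \bar R :=
  if N is Some n then (powR (n%:R) r)%:E else (+oo)%E.

Definition decides {R : realType} {dO} {Om : measurableType dO} {dY} {Yt : measurableType dY}
  {L M : nat} (d0 : 'I_M) (f : 'I_L -> 'I_M -> 'I_M -> Yt -> R)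
  (Q : 'I_L -> 'I_M -> 'I_M -> R) (rh : 'I_L -> 'I_M -> R) (c : R)
  (Y : nat -> 'I_L -> 'I_M -> Om -> Yt) (U : nat -> 'I_L -> Om -> R)
  (i : 'I_M) : set Om :=
  [set w | exists n, Nstop d0 f Q rh c Y U w = Some n /\
                     forall l, last_dec d0 f Q rh c Y U l w n = Some i].

Definition ord0_of {M : nat} (hM : (1 < M)%N) : 'I_M := Ordinal (ltnW hM).

(* Main.v *)
(** The key point is that log-likelihood ratios have light lower tails under the true hypothesis
    [h_i]: the ratio [p_j / p_i] has mean at most 1, so falling below the drift is exponentially
    unlikely whatever the upper tails.  At one sensor, products over the observed steps of factors whose
    conditional mean is at most 1 are nonnegative supermartingales, and Ville's maximal inequality
    applies to them.

    - With the likelihood ratio itself, sensor [l] wrongly reaches the level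
      [exp (rho_{j,l} |log c|)] with probability at most [c ^ rho_{j,l}]; independence of the sensors
      and [\sum_l rho_{j,l} = 1] bound the probability of deciding [h_j] by [c].
    - With [(p_m / p_i)^(1-t) exp (b 1(i* = m))], the number of steps at which a wrong [h_m] leads
      has an exponential tail: when [m] leads, its own action distribution separates [m] from [i],
      and the ratio is at least 1 at those times.
    - With [(p_j / p_i)^t exp (b 1(i* = i))] and [b] close to [t v_i], the ratio of [h_j] to [h_i]
      after [n] steps exceeds [exp (- (1 - eps) v_i n)] with exponentially small probability.

    Hence the events that some sensor misses its threshold at time [n], for [n] above
    [(1 + eps) |log c| / I(i)], are contained in events independent of [c] whose probabilities decay
    exponentially, and [E N^r <= ((1 + eps) |log c| / I(i))^r + O(1)] for every [r >= 1]. *)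
Require Import Defs.
From HB Require Import structures.
From mathcomp Require Import all_boot all_order all_algebra.
From mathcomp Require Import all_classical all_reals all_analysis.
From mathcomp Require Import measurable_realfun ring lra.
Import Order.TTheory GRing.Theory Num.Theory.
Import numFieldNormedType.Exports.
Local Open Scope classical_set_scope.
Local Open Scope ring_scope.

Set Implicit Arguments.
Unset Strict Implicit.

(** * Independence of generated sigma-algebras *)

Lemma bigsetI_seqP (T : Type) (I : eqType) (s : seq I) (A : I -> set T) w :
  (\big[setI/setT]_(x <- s) A x) w <-> (forall x, x \in s -> A x w).
Proof.
elim: s => [|x s IH]; first by rewrite big_nil; split.
rewrite big_cons; split.
  by move=> [Ax /IH As] y; rewrite inE => /predU1P[->//|]; exact: As.
move=> As; split; first by apply: As; rewrite mem_head.
by apply/IH => y ys; apply: As; rewrite inE ys orbT.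
Qed.

Section independence.
Context {d} {T : measurableType d} {R : realType} (P : probability T R).

Section dynkin_independence.
Variable B : set T.
Hypothesis mB : measurable B.

Lemma dynkin_indep : dynkin [set A | measurable A /\ (P (A `&` B) = P A * P B)%E].
Proof.
split => /=.
- by split; [exact: measurableT|rewrite setTI probability_setT mul1e].
- move=> A [mA AB]; split; first exact: measurableC.
  have PA : P A \is a fin_num by exact: fin_num_measure.
  have PB : P B \is a fin_num by exact: fin_num_measure.
  rewrite setIC -setDE measureD//=; last by rewrite ltey_eq PB.
  rewrite setIC AB probability_setC// muleBl ?mul1e //.
- move=> F tF HF.
  have mF n : measurable (F n) by have [] := HF n.
  split; first exact: bigcupT_measurable.
  rewrite setI_bigcupl measure_bigcup//=; last 2 first.
  + by move=> n _; exact: measurableI.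
  + by apply: trivIset_setIr.
  rewrite measure_bigcup// muleC -(fineK (fin_num_measure P _ mB)) -nneseriesZl//.
  apply: eq_eseriesr => n _; have [_ ->] := HF n.
  by rewrite muleC fineK// fin_num_measure.
Qed.
End dynkin_independence.

Variables (I : eqType) (S : I -> set (set T)).
Hypotheses (Smeas : forall x A, S x A -> measurable A) (ST : forall x, S x setT)
  (SI : forall x, setI_closed (S x)).

Definition gen (K : set I) : set (set T) := [set A | exists2 x, K x & S x A].

(** Finite intersections turn [gen K] into a pi-system with the same generated sigma-algebra; events
    with different indices in [gen K] need not have their intersection in [gen K]. *)
Definition cyl (K : set I) : set (set T) :=
  [set X | exists s A, [/\ uniq s, (forall x, x \in s -> K x), (forall x, S x (A x)) &
     X = \big[setI/setT]_(x <- s) A x]].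

Lemma cyl_setI K : setI_closed (cyl K).
Proof.
move=> _ _ [s1 [A1 [u1 K1 S1 ->]]] [s2 [A2 [u2 K2 S2 ->]]].
pose A x := (if x \in s1 then A1 x else setT) `&` (if x \in s2 then A2 x else setT).
exists (undup (s1 ++ s2)), A; split.
- exact: undup_uniq.
- by move=> x; rewrite mem_undup mem_cat => /orP[/K1|/K2].
- by move=> x; apply: SI; case: ifP.
- apply/seteqP; split => w.
    move=> [/bigsetI_seqP h1 /bigsetI_seqP h2]; apply/bigsetI_seqP => x _.
    by split; case: ifP => // h; [exact: h1|exact: h2].
  move/bigsetI_seqP => h; split; apply/bigsetI_seqP => x xs.
  + by have [] := h x; rewrite ?mem_undup ?mem_cat xs.
  + by have [] := h x; rewrite ?mem_undup ?mem_cat xs ?orbT.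
Qed.

Lemma cyl_measurable K A : cyl K A -> measurable A.
Proof.
move=> [s [B [_ _ SB ->]]]; elim: s => [|x s IH]; first by rewrite big_nil; exact: measurableT.
by rewrite big_cons; apply: measurableI => //; exact: Smeas (SB x).
Qed.

Lemma gen_cyl K : gen K `<=` cyl K.
Proof.
move=> A [x Kx SA]; exists [:: x], (fun y => if y == x then A else setT); split => //.
- by move=> y; rewrite inE => /eqP ->.
- by move=> y; case: eqP => [->//|_]; exact: ST.
- by rewrite big_seq1 eqxx.
Qed.

Lemma gen_measurable K : <<s gen K >> `<=` measurable.
Proof.
apply: smallest_sub; first exact: sigma_algebra_measurable.
by move=> A [x _ /Smeas].
Qed.

Lemma gen_sub K K' : K `<=` K' -> <<s gen K >> `<=` <<s gen K' >>.
Proof.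
by move=> KK'; apply: sub_sigma_algebra2 => A [x Kx SA]; exists x => //; exact: KK'.
Qed.

Hypothesis indep : forall (s : seq I) (A : I -> set T), uniq s -> (forall x, S x (A x)) ->
  P (\big[setI/setT]_(x <- s) A x) = (\prod_(x <- s) P (A x))%E.

(** Disjointness of [K] and [K'] lets the two finite families merge into one without repeated index,
    to which [indep] applies. *)
Lemma indep_cyl K K' A B : (forall x, K x -> ~ K' x) -> cyl K A -> cyl K' B ->
  (P (A `&` B) = P A * P B)%E.
Proof.
move=> KK' [s [C [us Ks SC ->]]] [t [D [ut Kt SD ->]]].
have st x : x \in s -> x \in t -> False.
  by move=> /Ks /KK' Kx /Kt.
pose E x := if x \in s then C x else D x.
have SE x : S x (E x) by rewrite /E; case: ifP.
have -> : \big[setI/setT]_(x <- s) C x = \big[setI/setT]_(x <- s) E x.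
  by apply: eq_big_seq => x xs; rewrite /E xs.
have -> : \big[setI/setT]_(x <- t) D x = \big[setI/setT]_(x <- t) E x.
  by apply: eq_big_seq => x xt; rewrite /E; case: ifP => // xs; case: (st _ xs xt).
rewrite -big_cat !indep//; first by rewrite big_cat.
rewrite cat_uniq us ut andbT /=; apply/hasPn => x xt; apply/negP => xs; exact: st xs xt.
Qed.

(** Pi-lambda argument applied twice: first the left event varies against a fixed cylinder, then the
    right one against a fixed event of [<<s gen K >>]. *)
Lemma indep_gen K K' A B : (forall x, K x -> ~ K' x) -> <<s gen K >> A -> <<s gen K' >> B ->
  (P (A `&` B) = P A * P B)%E.
Proof.
move=> KK' sA sB.
have cylgen K0 : <<s gen K0 >> `<=` <<s cyl K0 >>.
  by apply: sub_sigma_algebra2; exact: gen_cyl.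
have step1 B' : cyl K' B' -> <<s cyl K >> `<=`
    [set A | measurable A /\ (P (A `&` B') = P A * P B')%E].
  move=> cB; apply: lambda_system_subset => //.
  - exact: cyl_setI.
  - by apply/dynkin_lambda_system/dynkin_indep; exact: cyl_measurable cB.
  - by move=> A' cA; split; [exact: cyl_measurable cA|exact: indep_cyl KK' cA cB].
have mA : measurable A by exact: gen_measurable sA.
suff : <<s cyl K' >> `<=` [set B | measurable B /\ (P (B `&` A) = P B * P A)%E].
  by move=> /(_ _ (cylgen _ _ sB))[_]; rewrite setIC muleC.
apply: lambda_system_subset => //.
- exact: cyl_setI.
- exact/dynkin_lambda_system/dynkin_indep.
- move=> B' cB; split; first exact: cyl_measurable cB.
  by have [_] := step1 _ cB _ (cylgen _ _ sA); rewrite setIC muleC.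
Qed.

End independence.

(** * Integration against densities and products of independent variables *)

Section density.
Context {d1 d2} {T1 : measurableType d1} {T2 : measurableType d2} {R : realType}.
Variables (m1 : {measure set T1 -> \bar R}) (m2 : {measure set T2 -> \bar R}).
Variables (Z : T1 -> T2) (p : T2 -> R).
Hypotheses (mZ : measurable_fun setT Z) (mp : measurable_fun setT p) (p0 : forall y, 0 <= p y).
Hypothesis law : forall A, measurable A -> m1 (Z @^-1` A) = (\int[m2]_(y in A) (p y)%:E)%E.

Import HBNNSimple.
Local Open Scope ereal_scope.

(** The law of [Z] is given on sets only; increasing simple functions carry it to [h], with monotone
    convergence on both sides. *)
Lemma integral_law (h : T2 -> R) : measurable_fun setT h -> (forall y, 0 <= h y)%R ->
  \int[m1]_w (h (Z w))%:E = \int[m2]_y (p y * h y)%:E.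
Proof.
move=> mh h0.
have mEh : measurable_fun setT (fun y => (h y)%:E) by exact/measurable_EFinP.
have h0' y : 0 <= (h y)%:E by rewrite lee_fin.
pose f_ := nnsfun_approx measurableT mEh.
have mf n : measurable_fun setT (f_ n) by exact: measurable_funP.
transitivity (limn (fun n => \int[m1]_w (f_ n (Z w))%:E)).
  rewrite -monotone_convergence//; last 3 first.
  - by move=> n; apply/measurable_EFinP; exact: (measurableT_comp (mf n)).
  - by move=> n w _; rewrite lee_fin.
  - by move=> w _ m n mn; rewrite lee_fin; exact/lefP/nd_nnsfun_approx.
  apply: eq_integral => w _; apply/esym/cvg_lim => //.
  by apply: cvg_nnsfun_approx.
transitivity (limn (fun n => \int[m2]_y (p y * f_ n y)%:E)); last first.
  rewrite -monotone_convergence//; last 3 first.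
  - by move=> n; apply/measurable_EFinP; exact: measurable_funM.
  - by move=> n y _; rewrite lee_fin mulr_ge0.
  - move=> y _ m n mn; rewrite lee_fin ler_wpM2l//.
    exact/lefP/nd_nnsfun_approx.
  apply: eq_integral => y _; apply/cvg_lim => //.
  under eq_fun do rewrite EFinM.
  rewrite EFinM; apply: cvgeZl => //.
  by apply: cvg_nnsfun_approx.
congr (limn _); apply/funext => n.
have mA r : measurable (f_ n @^-1` [set r]) by rewrite -[X in measurable X]setTI; exact: mf.
have mZA r : measurable (Z @^-1` (f_ n @^-1` [set r])).
  by rewrite -[X in measurable X]setTI; exact: mZ.
transitivity (\sum_(k \in range (f_ n)) k%:E * m1 (Z @^-1` (f_ n @^-1` [set k]))).
  transitivity (\int[m1]_w \sum_(k \in range (f_ n))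
      (k * \1_(Z @^-1` (f_ n @^-1` [set k])) w)%:E).
    by apply: eq_integral => w _; rewrite fsumEFin// fimfunE.
  rewrite ge0_integral_fsum//; last 2 first.
  - by move=> r; apply/measurable_EFinP; exact: measurable_funM.
  - by move=> r w _; rewrite (nnfun_muleindic_ge0 (f_ n) r (Z w)).
  apply: eq_fsbigr => r _.
  rewrite (integralZl_indic _ (fun r => Z @^-1` (f_ n @^-1` [set r])))//.
    by rewrite integral_indic// setIT.
  by move=> r0; rewrite preimage_nnfun0// preimage_set0.
transitivity (\int[m2]_y \sum_(k \in range (f_ n))
      (k * (p y * \1_(f_ n @^-1` [set k]) y))%:E); last first.
  apply: eq_integral => y _; rewrite fsumEFin//; congr EFin.
  rewrite [in RHS]fimfunE mulr_fsumr; apply: eq_fsbigr => r _.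
  by rewrite mulrCA.
have fk0 r y : 0 <= (r * (p y * \1_(f_ n @^-1` [set r]) y))%:E.
  by rewrite mulrCA EFinM mule_ge0 ?lee_fin//; exact: (nnfun_muleindic_ge0 (f_ n) r y).
have mfk r : measurable_fun setT (fun y => (p y * \1_(f_ n @^-1` [set r]) y)%:E).
  by apply/measurable_EFinP; apply: measurable_funM.
rewrite ge0_integral_fsum//; last first.
  move=> r; apply/measurable_EFinP; apply: measurable_funM => //.
  exact: measurable_funM.
apply: eq_fsbigr => r /set_mem[y _ fr].
have r0 : (0 <= r)%R by rewrite -fr.
under [RHS]eq_integral do rewrite EFinM.
rewrite ge0_integralZl//; last by move=> z _; rewrite lee_fin mulr_ge0.
rewrite law//; congr (_ * _).
rewrite integral_mkcond; apply: eq_integral => z _.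
rewrite /restrict/patch/= indicE.
by case: ifP; rewrite ?mulr1 ?mulr0.
Qed.
End density.

Section expectation_product.
Context {d} {T : measurableType d} {R : realType} (P : probability T R).
Local Open Scope ereal_scope.

(** Rectangles determine the joint law of [g] and [h], so it is the product measure, and Tonelli
    splits the integral. *)
Lemma integral_indepM (g h : T -> R) :
  measurable_fun setT g -> measurable_fun setT h ->
  (forall w, 0 <= g w)%R -> (forall w, 0 <= h w)%R ->
  (forall A B : set R, measurable A -> measurable B ->
     P (g @^-1` A `&` h @^-1` B) = P (g @^-1` A) * P (h @^-1` B)) ->
  \int[P]_w (g w * h w)%:E = \int[P]_w (g w)%:E * \int[P]_w (h w)%:E.
Proof.
move=> mg mh g0 h0 ind.
pose gm : {mfun T >-> R} := HB.pack g (isMeasurableFun.Build _ _ _ _ _ mg).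
pose hm : {mfun T >-> R} := HB.pack h (isMeasurableFun.Build _ _ _ _ _ mh).
pose gh w := (g w, h w).
have mgh : measurable_fun setT gh by exact: measurable_fun_pair.
pose ghm : {mfun T >-> (R * R)%type} := HB.pack gh (isMeasurableFun.Build _ _ _ _ _ mgh).
(* Absolute values make the integrand nonnegative on the whole plane, as Tonelli requires; they
   disappear on the range of [(g, h)]. *)
pose F (z : (R * R)%type) : \bar R := (`|z.1| * `|z.2|)%:E.
have mF : measurable_fun setT F.
  by apply/measurable_EFinP; apply: measurable_funM; exact: measurableT_comp.
have F0 z : 0 <= F z by rewrite lee_fin mulr_ge0.
have mabs : measurable_fun setT (fun x : R => `|x|%:E).
  by apply/measurable_EFinP; exact: normr_measurable.
transitivity (\int[distribution P ghm]_z F z).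
  rewrite ge0_integral_pushforward//.
  by apply: eq_integral => w _; rewrite /F/= !ger0_norm.
transitivity (\int[distribution P gm \x distribution P hm]_z F z).
  apply: eq_measure_integral => A mA _.
  apply/esym/product_measure_unique => //=.
rewrite fubini_tonelli1//.
transitivity (\int[distribution P gm]_x (`|x|%:E * \int[P]_w (h w)%:E)).
  apply: eq_integral => x _; rewrite /fubini_F.
  under eq_integral do rewrite /F/= EFinM.
  rewrite ge0_integralZl//; congr (_ * _).
  rewrite ge0_integral_pushforward//.
  by apply: eq_integral => w _ /=; rewrite ger0_norm.
rewrite ge0_integralZr//; last by apply: integral_ge0 => w _; rewrite lee_fin.
congr (_ * _).
rewrite ge0_integral_pushforward//.
by apply: eq_integral => w _ /=; rewrite ger0_norm.
Qed.
End expectation_product.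

(** * Pointwise inequalities for likelihood ratios *)

Section pointwise_bounds.
Context {R : realType}.
Implicit Types s t x y z p q : R.

Lemma expR_le_quadratic z : z <= 2^-1 -> expR z <= 1 + z + 2 * z ^+ 2.
Proof.
move=> z2; have z1 : 0 < 1 - z by lra.
have e1 : 1 - z <= expR (- z) by have := expR_ge1Dx (- z).
have e2 : expR z <= (1 - z)^-1.
  by rewrite -[expR z]invrK -expRN lef_pV2 ?posrE ?expR_gt0.
apply: (le_trans e2); rewrite -[leLHS]mul1r ler_pdivrMr//.
have -> : (1 + z + 2 * z ^+ 2) * (1 - z) = 1 + z ^+ 2 * (1 - 2 * z) by ring.
by rewrite lerDl mulr_ge0 ?sqr_ge0//; lra.
Qed.

(* The second-order error for large negative [s] is absorbed by [expR (- s)], which becomes the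
   integrable density ratio: [s ^+ 2 <= 16 * expR (- s / 2)]. *)
Lemma expR_tilt_le t s : 0 < t -> t <= 2^-1 ->
  expR (- (t * s)) <= 1 - t * s + 2 * t ^+ 2 * s ^+ 2 + 64 * t ^+ 2 * expR (- s).
Proof.
move=> t0 t2; have [z2|z2] := leP (- (t * s)) (2^-1).
  have := expR_le_quadratic z2 => h.
  have h' : 0 <= 64 * t ^+ 2 * expR (- s) by rewrite mulr_ge0 ?expR_ge0// mulr_ge0 ?sqr_ge0.
  have E : 2 * (- (t * s)) ^+ 2 = 2 * t ^+ 2 * s ^+ 2 by ring.
  rewrite E in h; lra.
have s0 : s < 0 by rewrite -(pmulr_rlt0 _ t0); lra.
have e1 : expR (- (t * s)) <= expR (- s / 2) by rewrite ler_expR; nra.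
have e2 : - s / 4 <= expR (- s / 4) by have := expR_ge1Dx (- s / 4); lra.
have E2 : expR (- s / 2) = expR (- s / 4) ^+ 2.
  by rewrite expr2 -expRD; congr expR; field.
have E4 : expR (- s) = expR (- s / 2) ^+ 2.
  by rewrite expr2 -expRD; congr expR; field.
have e3 : (- s / 4) ^+ 2 <= expR (- s / 2) by rewrite E2 ler_pXn2r ?nnegrE ?expR_ge0//; lra.
have e4 : 1 <= 64 * t ^+ 2 * expR (- s / 2).
  have h : 4 * (t * s) ^+ 2 <= 64 * t ^+ 2 * expR (- s / 2).
    rewrite (_ : 4 * (t * s) ^+ 2 = 64 * t ^+ 2 * (- s / 4) ^+ 2); last by field.
    by rewrite ler_wpM2l// mulr_ge0 ?sqr_ge0.
  by apply: le_trans h; nra.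
have e5 : expR (- s / 2) <= 64 * t ^+ 2 * expR (- s).
  have -> : 64 * t ^+ 2 * expR (- s) = 64 * t ^+ 2 * expR (- s / 2) * expR (- s / 2).
    by rewrite E4; ring.
  by rewrite ler_peMl ?expR_ge0.
have : 0 <= 2 * t ^+ 2 * s ^+ 2 by rewrite mulr_ge0 ?sqr_ge0// mulr_ge0 ?sqr_ge0.
lra.
Qed.

(** Weighted AM-GM between [1] and [x]: add [ln y <= y - 1] at [x / a] and at [1 / a] with weights
    [t] and [1 - t], where [a] is the right-hand side. *)
Lemma powR_le_affine t x : 0 < t -> t < 1 -> 0 <= x -> x `^ t <= 1 - t + t * x.
Proof.
move=> t0 t1; rewrite le_eqVlt => /predU1P[<-|x0].
  by rewrite powR0 ?gt_eqF// mulr0; lra.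
set a := 1 - t + t * x.
have tx : 0 < t * x by rewrite mulr_gt0.
have a0 : 0 < a by rewrite /a; lra.
have lnle y : 0 < y -> ln y <= y - 1.
  by move=> y0; have := le_ln1Dx (x := y - 1); rewrite addrCA subrr addr0; apply; lra.
have h1 := lnle (x / a) (divr_gt0 x0 a0).
have h2 : ln a^-1 <= a^-1 - 1 by apply: lnle; rewrite invr_gt0.
rewrite ln_div ?posrE// in h1; rewrite lnV ?posrE// in h2.
have h3 : t * (x / a - 1) + (1 - t) * (a^-1 - 1) = 0 by rewrite /a; field; rewrite gt_eqF.
rewrite -ler_ln ?posrE ?powR_gt0// ln_powR.
nra.
Qed.

(* Valid also for [q = 0 < p], where [ln (p / q)] takes the junk value [ln 0 = 0]. *)
Lemma density_tilt_le t p q : 0 < t -> t <= 2^-1 -> 0 <= p -> 0 <= q ->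
  p * (q / p) `^ t <= p - t * (p * ln (p / q))
     + (2 * t ^+ 2 * (p * ln (p / q) ^+ 2) + 64 * t ^+ 2 * q).
Proof.
move=> t0 t2; rewrite le_eqVlt => /predU1P[<-|p0].
  by move=> q0; rewrite !mul0r !mulr0 oppr0 !add0r mulr_ge0// mulr_ge0 ?sqr_ge0.
rewrite le_eqVlt => /predU1P[<-|q0].
  rewrite mul0r powR0 ?gt_eqF// invr0 !mulr0 ln0// !mulr0 subr0 expr0n !mulr0.
  lra.
have -> : q / p = expR (- ln (p / q)).
  by rewrite expRN lnK ?posrE ?divr_gt0// invf_div.
have -> : expR (- ln (p / q)) `^ t = expR (- (t * ln (p / q))).
  by rewrite -expRM mulNr mulrC.
have e := expR_tilt_le (ln (p / q)) t0 t2.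
have E : q = p * expR (- ln (p / q)).
  by rewrite expRN lnK ?posrE ?divr_gt0// invf_div mulrC divfK// gt_eqF.
rewrite [in X in _ <= _ + (_ + X)]E.
rewrite (_ : _ + _ = p * (1 - t * ln (p / q) + 2 * t ^+ 2 * ln (p / q) ^+ 2
   + 64 * t ^+ 2 * expR (- ln (p / q)))); last by ring.
by rewrite ler_pM2l.
Qed.

Lemma density_tilt_le_affine t p q : 0 < t -> t < 1 -> 0 <= p -> 0 <= q ->
  p * (q / p) `^ t <= (1 - t) * p + t * q.
Proof.
move=> t0 t1; rewrite le_eqVlt => /predU1P[<-|p0] q0.
  by rewrite mul0r mulr0 add0r mulr_ge0// ltW.
have := powR_le_affine t0 t1 (divr_ge0 q0 (ltW p0)).
rewrite -(ler_pM2l p0) => /le_trans; apply.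
by rewrite mulrDr mulrC mulrCA [p * _]mulrC divfK ?gt_eqF.
Qed.

(** Serves to move an expectation under the true hypothesis to one under a wrong leader. When a
    density is zero both sides vanish. *)
Lemma density_tiltC t p q : 0 < t -> t < 1 -> 0 <= p -> 0 <= q ->
  p * (q / p) `^ (1 - t) = q * (p / q) `^ t.
Proof.
move=> t0 t1; rewrite le_eqVlt => /predU1P[<-|p0].
  by move=> _; rewrite !mul0r powR0 ?gt_eqF// mulr0.
rewrite le_eqVlt => /predU1P[<-|q0].
  by rewrite !mul0r powR0 ?mulr0// gt_eqF// subr_gt0.
have d0 : 0 < q / p by rewrite divr_gt0.
rewrite powRD; last by apply/implyP => _; rewrite gt_eqF.
rewrite powRr1 ?ltW// mulrA [p * _]mulrC divfK ?gt_eqF// powRN.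
by rewrite -powR_inv1 ?powR_ge0// -powRrM mulrN1 powRN -[in RHS]invf_div -[in RHS]powR_inv1
  ?ltW// -[in RHS]powRrM mulN1r powRN.
Qed.

(** This is [ln x <= x - 1] at [q / p]; the last hypothesis excludes [q = 0 < p], where the junk
    value [ln 0 = 0] would break it. *)
Lemma density_ln_ge p q : 0 <= p -> 0 <= q -> (q = 0 -> p = 0) -> p - q <= p * ln (p / q).
Proof.
move=> p0; rewrite le_eqVlt => /predU1P[<-|q0].
  by move=> /(_ erefl) ->; rewrite mul0r subr0.
move: p0; rewrite le_eqVlt => /predU1P[<- _|p0 _].
  by rewrite mul0r; lra.
have h : ln (q / p) <= q / p - 1.
  have := le_ln1Dx (x := q / p - 1); rewrite addrCA subrr addr0; apply.
  have : 0 < q / p by rewrite divr_gt0.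
  lra.
have -> : ln (p / q) = - ln (q / p) by rewrite -lnV ?posrE ?divr_gt0// invf_div.
rewrite mulrN; move: h; rewrite -(ler_pM2l p0) mulrBr mulr1 [p * (q / p)]mulrC divfK ?gt_eqF//.
lra.
Qed.
End pointwise_bounds.

(* Chernoff affinity [\int p ^ (1 - t) q ^ t]. *)
Definition aff {R : realType} {d} {T : measurableType d} (mu : {measure set T -> \bar R})
  (t : R) (p q : T -> R) : \bar R := (\int[mu]_y (p y * (q y / p y) `^ t)%:E)%E.

Lemma measurable_funV_ge0 {R : realType} {d} {T : measurableType d} (g : T -> R) :
  measurable_fun setT g -> (forall y, 0 <= g y) -> measurable_fun setT (fun y => (g y)^-1).
Proof.
move=> mg g0; rewrite (_ : (fun y => (g y)^-1) = (fun x => x `^ (-1)) \o g); last first.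
  by apply/funext => y /=; rewrite powR_inv1.
by apply: measurableT_comp => //; exact: measurable_powR.
Qed.

(** * Kullback-Leibler divergence and Chernoff affinity *)

Section divergence.
Context {R : realType} {d} {T : measurableType d} (mu : {measure set T -> \bar R}).
Implicit Types p q : T -> R.

Lemma density_integrable p : is_density mu p -> mu.-integrable setT (fun y => (p y)%:E).
Proof.
move=> [mp p0 p1]; apply/integrableP; split; first exact/measurable_EFinP.
rewrite (eq_integral (fun y => (p y)%:E)); last by move=> y _; rewrite /= ger0_norm.
by rewrite p1 ltry.
Qed.

Lemma measurable_ratio p q : is_density mu p -> is_density mu q ->
  measurable_fun setT (fun y => p y / q y).
Proof.
move=> [mp p0 _] [mq q0 _]; apply: measurable_funM => //.
exact: measurable_funV_ge0.
Qed.

Lemma measurable_llr p q : is_density mu p -> is_density mu q ->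
  measurable_fun setT (fun y => ln (p y / q y)).
Proof.
move=> dp dq; apply: (measurableT_comp (@measurable_ln R)); exact: measurable_ratio.
Qed.

Lemma measurable_tilt t p q : is_density mu p -> is_density mu q ->
  measurable_fun setT (fun y => p y * (q y / p y) `^ t).
Proof.
move=> dp dq; apply: measurable_funM; first by case: dp.
by apply: (measurableT_comp (@measurable_powR R t)); exact: measurable_ratio.
Qed.

Lemma aff_ge0 t p q : is_density mu p -> is_density mu q -> (0 <= aff mu t p q)%E.
Proof.
by move=> [_ p0 _] [_ q0 _]; apply: integral_ge0 => y _; rewrite lee_fin mulr_ge0 ?powR_ge0.
Qed.

Lemma aff_le1 t p q : 0 < t -> t < 1 -> is_density mu p -> is_density mu q ->
  (aff mu t p q <= 1)%E.
Proof.
move=> t0 t1 dp dq; have [mp p0 p1] := dp; have [mq q0 q1] := dq.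
have Ep y : (0 <= (p y)%:E)%E by rewrite lee_fin.
have Eq y : (0 <= (q y)%:E)%E by rewrite lee_fin.
apply: (@le_trans _ _ (\int[mu]_y ((1 - t)%:E * (p y)%:E + t%:E * (q y)%:E))%E).
  apply: ge0_le_integral => //.
  - by move=> y _; rewrite lee_fin mulr_ge0 ?powR_ge0.
  - by apply/measurable_EFinP; exact: measurable_tilt.
  - apply: emeasurable_funD; apply/measurable_EFinP; exact: measurable_funM.
  - by move=> y _; rewrite -!EFinM -EFinD lee_fin density_tilt_le_affine.
rewrite ge0_integralD//; last 4 first.
- by move=> y _; rewrite mule_ge0// lee_fin; lra.
- by apply/measurable_EFinP; exact: measurable_funM.
- by move=> y _; rewrite mule_ge0// lee_fin; lra.
- by apply/measurable_EFinP; exact: measurable_funM.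
rewrite !ge0_integralZl//; last 4 first.
- exact/measurable_EFinP.
- by rewrite lee_fin; lra.
- exact/measurable_EFinP.
- by rewrite lee_fin; lra.
by rewrite p1 q1 !mule1 -EFinD subrK.
Qed.

Lemma affC t p q : 0 < t -> t < 1 -> is_density mu p -> is_density mu q ->
  aff mu (1 - t) p q = aff mu t q p.
Proof.
move=> t0 t1 [_ p0 _] [_ q0 _]; apply: eq_integral => y _.
by rewrite density_tiltC.
Qed.

Section finite_divergence.
Variables p q : T -> R.
Hypotheses (dp : is_density mu p) (dq : is_density mu q).
Hypothesis klfin : (KL mu p q < +oo)%E.
Hypothesis secfin : (\int[mu]_y (p y * (ln (p y / q y)) ^+ 2)%:E < +oo)%E.

Let p0 y : 0 <= p y. Proof. by case: dp. Qed.
Let q0 y : 0 <= q y. Proof. by case: dq. Qed.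
Let mp : measurable_fun setT p. Proof. by case: dp. Qed.
Let mq : measurable_fun setT q. Proof. by case: dq. Qed.

Lemma KL_integralE : KL mu p q = (\int[mu]_y (p y * ln (p y / q y))%:E)%E.
Proof. by move: klfin; rewrite /KL; case: pselect. Qed.

Lemma KL_ac : {ae mu, forall y, q y = 0 -> p y = 0}.
Proof. by move: klfin; rewrite /KL; case: pselect. Qed.

Let integrable_sq : mu.-integrable setT (fun y => (p y * (ln (p y / q y)) ^+ 2)%:E).
Proof.
apply/integrableP; split.
  apply/measurable_EFinP; apply: measurable_funM => //.
  by apply: measurable_funX; exact: measurable_llr.
rewrite (eq_integral (fun y => (p y * (ln (p y / q y)) ^+ 2)%:E))//.
by move=> y _; rewrite /= ger0_norm// mulr_ge0 ?sqr_ge0.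
Qed.

Let mkl : measurable_fun setT (fun y => (p y * ln (p y / q y))%:E).
Proof. by apply/measurable_EFinP; apply: measurable_funM => //; exact: measurable_llr. Qed.

(** Dominated through [|x| <= 1 + x ^+ 2] by the density plus the second-moment integrand. *)
Lemma integrable_KL : mu.-integrable setT (fun y => (p y * ln (p y / q y))%:E).
Proof.
apply: (le_integrable measurableT mkl
  (g := fun y => ((p y)%:E + (p y * (ln (p y / q y)) ^+ 2)%:E)%E)).
- move=> y _; rewrite -EFinD !abse_EFin lee_fin normrM (ger0_norm (p0 y)).
  rewrite [leRHS]ger0_norm; last by rewrite addr_ge0// mulr_ge0 ?sqr_ge0.
  rewrite -[X in X + _]mulr1 -mulrDr ler_wpM2l//.
  set x := ln _; rewrite -[x ^+ 2]real_normK ?num_real//.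
  have := sqr_ge0 (`|x| - 1); have := normr_ge0 x; nra.
- by apply: integrableD => //; exact: density_integrable.
Qed.

Lemma KL_fin_num : KL mu p q \is a fin_num.
Proof. by rewrite KL_integralE; exact: integrable_fin_num integrable_KL. Qed.

(** Gibbs' inequality: [p - q <= p * ln (p / q)] is integrated off the null set where absolute
    continuity fails, and the left side has integral zero. *)
Lemma KL_ge0 : (0 <= KL mu p q)%E.
Proof.
rewrite KL_integralE.
have -> : (0 = \int[mu]_y ((p y)%:E - (q y)%:E))%E.
  rewrite integralB//; try exact: density_integrable.
  by case: dp => _ _ ->; case: dq => _ _ ->; rewrite subee.
have [N [mN N0 subN]] := KL_ac.
rewrite (negligible_integral mN)//; last first.
  by apply: integrableB => //; exact: density_integrable.
rewrite [leRHS](negligible_integral mN)//; last exact: integrable_KL.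
have mD : measurable (setT `\` N) by exact: measurableD.
apply: le_integral => //.
- apply: (integrableS measurableT) => //.
  by apply: integrableB => //; exact: density_integrable.
- by apply: (integrableS measurableT) => //; exact: integrable_KL.
- move=> y; rewrite inE => -[_ Ny]; rewrite -EFinB lee_fin density_ln_ge//.
  by apply: contrapT => h; apply: Ny; apply: subN.
Qed.

(** Second-order expansion of the affinity at [t = 0], with slope minus the divergence. The [64] is
    the coefficient of [q] in [density_tilt_le], and [q] has integral one. *)
Lemma aff_le t : 0 < t -> t <= 2^-1 ->
  (aff mu t p q <= (1 - t * fine (KL mu p q)
     + (2 * fine (\int[mu]_y (p y * (ln (p y / q y)) ^+ 2)%:E) + 64) * t ^+ 2)%:E)%E.
Proof.
move=> t0 t2.
have Ip := density_integrable dp; have Iq := density_integrable dq.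
have Ik := integrable_KL.
pose A y := ((p y)%:E - t%:E * (p y * ln (p y / q y))%:E)%E.
pose B y := ((2 * t ^+ 2)%:E * (p y * ln (p y / q y) ^+ 2)%:E + (64 * t ^+ 2)%:E * (q y)%:E)%E.
have IA : mu.-integrable setT A.
  by apply: integrableB => //; exact: integrableZl.
have IB : mu.-integrable setT B.
  by apply: integrableD => //; exact: integrableZl.
apply: (@le_trans _ _ (\int[mu]_y (A y + B y))%E).
  apply: ge0_le_integral => //.
  - by move=> y _; rewrite lee_fin mulr_ge0 ?powR_ge0.
  - by apply/measurable_EFinP; exact: measurable_tilt.
  - by apply: measurable_int; apply: integrableD => //; [exact: IA|exact: IB].
  - move=> y _; rewrite /A /B -!EFinM -EFinB -!EFinD lee_fin.
    exact: density_tilt_le.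
rewrite integralD// /A /B integralB//; last exact: integrableZl.
rewrite integralD//; try exact: integrableZl.
rewrite !integralZl//.
case: dp => _ _ ->; case: dq => _ _ ->.
rewrite -KL_integralE -(fineK KL_fin_num).
have Fs := integrable_fin_num measurableT integrable_sq.
rewrite -(fineK Fs) -!EFinM -EFinB -!EFinD lee_fin /=.
lra.
Qed.

End finite_divergence.
End divergence.

(** * Measurability of finite-valued functions *)

(** For a countable codomain this is measurability for the discrete sigma-algebra, stated through
    fibres so that [A] may be any type. *)
Definition dmeas {d} {T : measurableType d} {A : Type} (g : T -> A) :=
  forall a, measurable (g @^-1` [set a]).

Section dmeas.
Context {d} {T : measurableType d} {R : realType}.

Lemma dmeas_preimage (A : finType) (g : T -> A) (B : set A) :
  dmeas g -> measurable (g @^-1` B).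
Proof.
move=> mg; rewrite (_ : _ @^-1` _ = \bigcup_(a in B) g @^-1` [set a]).
  by apply: fin_bigcup_measurable => // a _; exact: mg.
by apply/seteqP; split => [w Bw|w [a Ba e]]; [by exists (g w)|by rewrite /= e].
Qed.

Lemma dmeas_comp (A : finType) (B : Type) (g : T -> A) (h : A -> B) :
  dmeas g -> dmeas (h \o g).
Proof. by move=> mg b; rewrite comp_preimage; exact: dmeas_preimage. Qed.

Lemma dmeas_pair (A B : finType) (g : T -> A) (h : T -> B) :
  dmeas g -> dmeas h -> dmeas (fun w => (g w, h w)).
Proof.
move=> mg mh [a b].
rewrite (_ : _ @^-1` _ = g @^-1` [set a] `&` h @^-1` [set b]); first exact: measurableI.
by apply/seteqP; split => [w [<- <-]//|w [/= <- <-]].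
Qed.

Lemma dmeas_bool (g : T -> bool) : dmeas g <-> measurable (g @^-1` [set true]).
Proof.
split=> [|mg [|]]; [exact|exact|].
rewrite (_ : _ @^-1` _ = ~` (g @^-1` [set true])); first exact: measurableC.
by apply/seteqP; split => w /=; case: (g w).
Qed.

Lemma dmeas_ffun (A B : finType) (b : A -> T -> B) :
  (forall a, dmeas (b a)) -> dmeas (fun w => [ffun a => b a w] : {ffun A -> B}).
Proof.
move=> mb v.
rewrite (_ : _ @^-1` _ = \big[setI/setT]_(a <- enum A) (b a @^-1` [set v a])).
  by apply: bigsetI_measurable => a _; exact: mb.
apply/seteqP; split => w.
  by move=> /= <-; apply/bigsetI_seqP => a _ /=; rewrite ffunE.
move/bigsetI_seqP => h; apply/ffunP => a; rewrite ffunE.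
by apply: h; rewrite mem_enum.
Qed.

Lemma dmeas_ler (F G : T -> R) : measurable_fun setT F -> measurable_fun setT G ->
  dmeas (fun w => F w <= G w).
Proof.
move=> mF mG; apply/dmeas_bool.
have := measurable_fun_le measurableT mF mG; rewrite setTI; congr measurable.
Qed.

(** The argmax depends on the point only through the finite table of pairwise comparisons. *)
Lemma dmeas_argmaxI (M : nat) (d0 : 'I_M) (F : 'I_M -> T -> R) :
  (forall j, measurable_fun setT (F j)) -> dmeas (fun w => argmaxI d0 (F ^~ w)).
Proof.
move=> mF.
pose g w := [ffun jm : 'I_M * 'I_M => F jm.2 w <= F jm.1 w].
pose h (b : {ffun 'I_M * 'I_M -> bool}) := odflt d0 [pick j | [forall m, b (j, m)]].
rewrite (_ : (fun w => _) = h \o g).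
  by apply/dmeas_comp/dmeas_ffun => -[j m]; exact: dmeas_ler.
apply/funext => w; rewrite /h /g /argmaxI /=; congr odflt; apply: eq_pick => j.
by apply: eq_forallb => m; rewrite ffunE.
Qed.

Lemma dmeas_select (A : finType) (B : Type) (g : T -> A) (h : A -> T -> B) :
  dmeas g -> (forall a, dmeas (h a)) -> dmeas (fun w => h (g w) w).
Proof.
move=> mg mh b.
rewrite (_ : _ @^-1` _ = \bigcup_(a in setT) (g @^-1` [set a] `&` h a @^-1` [set b])).
  by apply: fin_bigcup_measurable => // a _; apply: measurableI; [exact: mg|exact: mh].
by apply/seteqP; split => [w /= e|w [a _ [/= -> //]]]; exists (g w).
Qed.

Lemma measurable_select (A : finType) (g : T -> A) (h : A -> T -> R) :
  dmeas g -> (forall a, measurable_fun setT (h a)) ->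
  measurable_fun setT (fun w => h (g w) w).
Proof.
move=> mg mh.
rewrite (_ : (fun w => _) =
    (fun w => \sum_(a <- enum A) \1_(g @^-1` [set a]) w * h a w)).
  apply: measurable_sum => a; apply: measurable_funM => //.
apply/funext => w; rewrite big_enum /= (bigD1 (g w))//= big1 ?addr0.
  by rewrite indicE mem_set ?mul1r.
by move=> a ag; rewrite indicE memNset ?mul0r//= => e; rewrite e eqxx in ag.
Qed.

End dmeas.

Lemma dmeas_sample {R : realType} (M : nat) (d0 : 'I_M) (q : 'I_M -> R) :
  dmeas (sample d0 q : R -> _).
Proof.
pose g (x : R) := [ffun a : 'I_M => x < \sum_(b : 'I_M | (b <= a)%N) q b].
pose h (b : {ffun 'I_M -> bool}) := odflt d0 [pick j | b j].
rewrite (_ : sample d0 q = h \o g).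
  apply/dmeas_comp/dmeas_ffun => a; apply/dmeas_bool.
  rewrite (_ : _ @^-1` _ = `]-oo, (\sum_(b : 'I_M | (b <= a)%N) q b)[%classic)//.
apply/funext => x; rewrite /h /g /sample /=; congr odflt; apply: eq_pick => j.
by rewrite ffunE.
Qed.

(* [sample] uses [pick], which is only specified as some witness; inverse-cdf sampling needs that it
   is the least one. *)
Lemma pick_ord_minimal (M : nat) (p : pred 'I_M) (a : 'I_M) :
  [pick x | p x] = Some a -> p a /\ forall b : 'I_M, (b < a)%N -> ~~ p b.
Proof.
have -> : [pick x | p x] = ohead [seq x <- enum 'I_M | p x].
  by rewrite enumT /pick /enum_mem; congr ohead; apply: eq_filter.
have : sorted (fun x y : 'I_M => (x < y)%N) (enum 'I_M).
  by have := iota_ltn_sorted 0 M; rewrite -val_enum_ord sorted_map.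
have hmem b : b \in enum 'I_M by rewrite mem_enum.
move=> srt h.
have [s1 E] : exists s, [seq x <- enum 'I_M | p x] = a :: s.
  by move: h; case: [seq x <- _ | _] => // b s [->]; exists s.
have pa : p a.
  have : a \in [seq x <- enum 'I_M | p x] by rewrite E mem_head.
  by rewrite mem_filter => /andP[].
split => // b ba; apply/negP => pb.
have : b \in [seq x <- enum 'I_M | p x] by rewrite mem_filter pb hmem.
have : sorted (fun x y : 'I_M => (x < y)%N) [seq x <- enum 'I_M | p x].
  by apply: sorted_filter => // x y z; exact: ltn_trans.
rewrite E /= => pth; rewrite inE => /orP[/eqP be|bs].
  by rewrite be ltnn in ba.
have tr : transitive (fun x y : 'I_M => (x < y)%N) by move=> x y z; exact: ltn_trans.
have := order_path_min tr pth.
by move/allP => /(_ _ bs) /(ltn_trans ba); rewrite ltnn.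
Qed.

(** The samples giving [u] lie between two consecutive cumulative sums, at distance [q u], apart
    from the null point [1]. *)
Lemma sample_law {R : realType} (M : nat) (d0 : 'I_M) (q : 'I_M -> R) (u : 'I_M) :
  is_pmf q ->
  (lebesgue_measure (sample d0 q @^-1` [set u] `&` [set x : R | (0 <= x <= 1)%R])
     <= (q u)%:E)%E.
Proof.
move=> [q0 q1].
pose F (a : 'I_M) := \sum_(b : 'I_M | (b <= a)%N) q b.
have Fu : F u = \sum_(b : 'I_M | (b < u)%N) q b + q u.
  rewrite /F (bigD1 u)//= addrC; congr (_ + _); apply: eq_bigl => b.
  by rewrite ltn_neqAle andbC.
have sub : sample d0 q @^-1` [set u] `&` [set x : R | 0 <= x <= 1] `<=`
    `[F u - q u, F u]%classic `|` [set 1].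
  move=> x [/= + /andP[x0 x1]]; rewrite /sample.
  case E : [pick a | _] => [a|] /= au.
    left; rewrite /= in_itv /=; subst a.
    have [/ltW -> hmin] := pick_ord_minimal E; rewrite andbT Fu addrK.
    (* For a nonzero index, minimality of the pick at the preceding index gives the left endpoint;
       for index zero the smaller sum is empty. *)
    case: u Fu E hmin => -[|k] hk /= Fu E hmin.
      by rewrite big1.
    have := hmin (Ordinal (ltnW hk)) (leqnn _); rewrite -leNgt /=; apply: le_trans.
    exact: lexx.
  (* If no index is picked, the last cumulative sum, which is one, does not exceed [x]; so [x = 1],
     the only sample that yields the default [d0]. *)
  right; apply/eqP; rewrite eq_le x1 /= -q1.
  move: E; case: pickP => // none _.
  have M0 : (0 < M)%N by case: (M) u {Fu au none} => // -[].
  have lt : (M.-1 < M)%N by rewrite prednK.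
  have := none (Ordinal lt); move/negbT; rewrite -leNgt; apply: le_trans.
  rewrite le_eqVlt; apply/orP; left; apply/eqP; apply: eq_bigl => b.
  by rewrite /= -ltnS prednK// ltn_ord.
apply: (@le_trans _ _ (lebesgue_measure (`[F u - q u, F u]%classic `|` [set 1]))).
  apply: le_measure => //; rewrite inE.
    apply: measurableI; first by have := dmeas_sample d0 q u.
    rewrite (_ : [set x | _] = `[0, 1]%classic)//.
  exact: measurableU.
have Ru1 : (lebesgue_measure `[(F u - q u)%R, F u]%classic + lebesgue_measure [set 1%R : R] <= (q u)%:E)%E.
  rewrite lebesgue_measure_set1 adde0 lebesgue_measure_itv /= lte_fin.
  case: ifP => _; last by rewrite lee_fin.
  by rewrite -EFinB lee_fin opprB addrC subrK.
by apply: le_trans Ru1; exact: measureU2.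
Qed.

(** * Supermartingales along one sensor *)

(** Separates a joint family of sources into observations and randomizations, the two lists in which
    [indep_skeleton] is stated. *)
Lemma big_split_option (T : Type) (idx : T) (op : Monoid.com_law idx) (A : eqType) (B : eqType)
    (s : seq (A * option B)) (F : A * option B -> T) :
  \big[op/idx]_(x <- s) F x =
  op (\big[op/idx]_(x <- pmap (fun x : A * option B => omap (pair x.1) x.2) s) F (x.1, Some x.2))
     (\big[op/idx]_(a <- pmap (fun x : A * option B => if x.2 is Some _ then None else Some x.1) s)
         F (a, None)).
Proof.
elim: s => [|[a [b|]] s IH] /=; first by rewrite !big_nil Monoid.mulm1.
  by rewrite !big_cons IH Monoid.mulmA.
by rewrite !big_cons IH Monoid.mulmCA.
Qed.

Section process.
Context {R : realType} {L M : nat} {dY} {Yt : measurableType dY} (mu : {measure set Yt -> \bar R}).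
Variables (f : 'I_L -> 'I_M -> 'I_M -> Yt -> R) (Q : 'I_L -> 'I_M -> 'I_M -> R) (d0 : 'I_M).
Context {dO} {Om : measurableType dO} (P : probability Om R).
Variables (Y : nat -> 'I_L -> 'I_M -> Om -> Yt) (U : nat -> 'I_L -> Om -> R) (i : 'I_M).
Hypothesis dens : forall l u i, is_density mu (f l u i).
Hypothesis pmfQ : forall l m, is_pmf (Q l m).
Hypothesis sk : skeleton P mu (fun l u => f l u i) Y U.

(* [(k, l, Some u)] indexes the observation [Y k l u], [(k, l, None)] the randomization [U k l]. *)
Local Notation idx := (nat * 'I_L * option 'I_M)%type.

Definition src (x : idx) : set (set Om) :=
  if x.2 is Some u then [set X | exists2 A, measurable A & X = Y x.1.1 x.1.2 u @^-1` A]
  else [set X | exists2 B, measurable B & X = U x.1.1 x.1.2 @^-1` B].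

Lemma src_measurable x A : src x A -> measurable A.
Proof.
case: sk => mY mU _ _ _; rewrite /src; case: x => [[k l] [u|]] /= [B mB ->];
  rewrite -[X in measurable X]setTI; [exact: mY|exact: mU].
Qed.

Lemma srcT x : src x setT.
Proof. by rewrite /src; case: x => [a [u|]] /=; exists setT. Qed.

Lemma srcI x : setI_closed (src x).
Proof.
rewrite /src; case: x => [a [u|]] /= _ _ [A mA ->] [B mB ->];
  by exists (A `&` B); [exact: measurableI|rewrite preimage_setI].
Qed.

Lemma src_indep (s : seq idx) (A : idx -> set Om) : uniq s -> (forall x, src x (A x)) ->
  P (\big[setI/setT]_(x <- s) A x) = (\prod_(x <- s) P (A x))%E.
Proof.
case: sk => _ _ _ _ ind us sA.
have /choice[B hB] : forall y : nat * 'I_L * 'I_M, exists B : set Yt,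
    measurable B /\ A (y.1, Some y.2) = Y y.1.1 y.1.2 y.2 @^-1` B.
  by move=> [a u]; have [B mB E] := sA (a, Some u); exists B.
have /choice[C hC] : forall y : nat * 'I_L, exists B : set R,
    measurable B /\ A (y, None) = U y.1 y.2 @^-1` B.
  by move=> a; have [C mC E] := sA (a, None); exists C.
rewrite !big_split_option.
under [X in P (X `&` _)]eq_bigr do rewrite (hB _).2.
under [X in P (_ `&` X)]eq_bigr do rewrite (hC _).2.
rewrite ind.
- by congr (_ * _)%E; apply: eq_bigr => y _; rewrite ?(hB _).2 ?(hC _).2.
- by apply: (pmap_uniq (g := fun y => (y.1, Some y.2))) => // -[a [u|]].
- by apply: (pmap_uniq (g := fun y => (y, None))) => // -[a [u|]].
- by move=> x; exact: (hB x).1.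
- by move=> x; exact: (hC x).1.
Qed.

Definition src_sigma (K : set idx) : set (set Om) := <<s gen src K >>.
(** [Om] with the sigma-algebra generated by the sources in [K]; being adapted becomes ordinary
    measurability on this type. *)
Definition src_sigmaType (K : set idx) := g_sigma_algebraType (gen src K).
Definition past (l : 'I_L) (n : nat) : set idx := [set x | x.1.2 = l /\ (x.1.1 < n)%N].
Definition sensor (l : 'I_L) : set idx := [set x | x.1.2 = l].

Lemma sig_indep K K' A B : (forall x, K x -> ~ K' x) -> src_sigma K A -> src_sigma K' B ->
  P (A `&` B) = (P A * P B)%E.
Proof.
exact: indep_gen src_measurable srcT srcI src_indep _ _ _ _.
Qed.

Lemma sig_measurable K A : src_sigma K A -> measurable A.
Proof. exact: (gen_measurable src_measurable). Qed.

Lemma sig_sub K K' A : K `<=` K' -> src_sigma K A -> src_sigma K' A.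
Proof. by move=> /(@gen_sub _ _ _ src); exact. Qed.

Lemma measurable_sub K K' (g : Om -> R) : K `<=` K' ->
  measurable_fun (setT : set (src_sigmaType K)) g -> measurable_fun (setT : set (src_sigmaType K')) g.
Proof.
move=> KK' mg mD B mB; apply: (sig_sub KK').
by apply: (mg _ B mB); exact: (@measurableT _ (src_sigmaType K)).
Qed.

Lemma measurable_sig K (g : Om -> R) :
  measurable_fun (setT : set (src_sigmaType K)) g -> measurable_fun setT g.
Proof.
move=> mg mD B mB; apply: (@sig_measurable K).
by apply: (mg _ B mB); exact: (@measurableT _ (src_sigmaType K)).
Qed.

Lemma sig_preimage K (g : Om -> R) B : measurable_fun (setT : set (src_sigmaType K)) g ->
  measurable B -> src_sigma K (g @^-1` B).
Proof.
move=> mg mB; have := mg (@measurableT _ (src_sigmaType K)) B mB.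
by rewrite setTI.
Qed.

Lemma integral_sigM K K' (g h : Om -> R) : (forall x, K x -> ~ K' x) ->
  measurable_fun (setT : set (src_sigmaType K)) g -> measurable_fun (setT : set (src_sigmaType K')) h ->
  (forall w, 0 <= g w) -> (forall w, 0 <= h w) ->
  (\int[P]_w (g w * h w)%:E = \int[P]_w (g w)%:E * \int[P]_w (h w)%:E)%E.
Proof.
move=> KK' mg mh g0 h0; apply: integral_indepM => //.
- exact: measurable_sig mg.
- exact: measurable_sig mh.
- by move=> A B mA mB; apply: (sig_indep KK'); exact: sig_preimage.
Qed.

Lemma measurable_Y k l u (g : Yt -> R) K : K (k, l, Some u) -> measurable_fun setT g ->
  measurable_fun (setT : set (src_sigmaType K)) (fun w => g (Y k l u w)).
Proof.
move=> Kx mg _ B mB; rewrite setTI; apply: sub_sigma_algebra; exists (k, l, Some u) => //.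
exists (g @^-1` B) => //; rewrite -[X in measurable X]setTI; exact: mg.
Qed.

Lemma sig_U k l K B : K (k, l, None) -> measurable B -> src_sigma K (U k l @^-1` B).
Proof.
move=> Kx mB; apply: sub_sigma_algebra; exists (k, l, None) => //; by exists B.
Qed.

Section one_sensor.
Variable l : 'I_L.

Local Notation H w n := (hist d0 f Q Y U l w n).
Definition ist (n : nat) (w : Om) : 'I_M := istar d0 f l (H w n).
Definition act (n : nat) (w : Om) : 'I_M := sample d0 (Q l (ist n w)) (U n l w).
Definition lk (j : 'I_M) (n : nat) (w : Om) : R := lik f l (H w n) j.

Lemma lk0 j w : lk j 0 w = 1.
Proof. by rewrite /lk /lik big_nil. Qed.

Lemma lkS j n w : lk j n.+1 w = lk j n w * f l (act n w) j (Y n l (act n w) w).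
Proof. by rewrite /lk /lik /= big_rcons. Qed.

Lemma dmeas_sigS (A : Type) (g : Om -> A) K K' : K `<=` K' ->
  dmeas (g : src_sigmaType K -> A) -> dmeas (g : src_sigmaType K' -> A).
Proof. by move=> KK' mg a; apply: (sig_sub KK'); exact: mg. Qed.

Lemma past_sub n m : (n <= m)%N -> past l n `<=` past l m.
Proof. by move=> nm x [e h]; split => //; exact: leq_trans nm. Qed.

Lemma dmeas_act n : dmeas (ist n : src_sigmaType (past l n) -> _) ->
  dmeas (act n : src_sigmaType (past l n.+1) -> _).
Proof.
move=> mi u.
have -> : act n @^-1` [set u] =
    \bigcup_(m in setT) (ist n @^-1` [set m] `&` U n l @^-1` (sample d0 (Q l m) @^-1` [set u])).
  apply/seteqP; split => [w h|w [m _ [/= <-]]//].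
  by exists (ist n w).
apply: (@fin_bigcup_measurable _ (src_sigmaType (past l n.+1))) => // m _.
apply: (@measurableI _ (src_sigmaType (past l n.+1))).
  by apply: (dmeas_sigS (past_sub (leqnSn n))).
apply: sig_U; first by split.
exact: dmeas_sample.
Qed.

Lemma dmeas_ist n : (forall j, measurable_fun (setT : set (src_sigmaType (past l n))) (lk j n)) ->
  dmeas (ist n : src_sigmaType (past l n) -> _).
Proof.
move=> ml; apply: (dmeas_argmaxI (T := src_sigmaType (past l n)) d0
  (F := fun j w => post f l (H w n) j)) => j.
apply: measurable_funM; first exact: ml.
apply: measurable_funV_ge0.
  by apply: measurable_sum => m; exact: ml.
by move=> w; apply: sumr_ge0 => m _; apply: prodr_ge0 => x _; case: (dens l x.1 m).
Qed.

Lemma measurable_step n (g : 'I_M -> 'I_M -> Yt -> R) (h : Om -> R) :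
  (forall m u, measurable_fun setT (g m u)) ->
  dmeas (ist n : src_sigmaType (past l n) -> _) ->
  measurable_fun (setT : set (src_sigmaType (past l n))) h ->
  measurable_fun (setT : set (src_sigmaType (past l n.+1)))
    (fun w => h w * g (ist n w) (act n w) (Y n l (act n w) w)).
Proof.
move=> mg mi mh.
have sub := past_sub (leqnSn n).
apply: measurable_funM; first exact: measurable_sub mh.
apply: (@measurable_select _ (src_sigmaType (past l n.+1)) R _
  (fun w => (ist n w, act n w)) (fun mu w => g mu.1 mu.2 (Y n l mu.2 w))).
  by apply: dmeas_pair; [exact: dmeas_sigS mi|exact: dmeas_act].
by move=> [m u] /=; apply: (measurable_Y (k := n) (l := l) (u := u)) => //; split.
Qed.

(** The leader at time [n] is read off the likelihoods at [n], and the likelihoods at [n.+1] involve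
    that leader through the action; the induction closes this loop. *)
Lemma measurable_lk n j : measurable_fun (setT : set (src_sigmaType (past l n))) (lk j n).
Proof.
elim: n j => [|n IH] j.
  by rewrite (_ : lk j 0 = cst 1); [exact: measurable_cst|apply/funext => w; exact: lk0].
rewrite (_ : lk j n.+1 = fun w => lk j n w * f l (act n w) j (Y n l (act n w) w)).
  apply: (measurable_step (g := fun _ u => f l u j)) => //; last exact: dmeas_ist.
  by move=> _ u; case: (dens l u j).
by apply/funext => w; exact: lkS.
Qed.

Lemma dmeas_istT n : dmeas (ist n : src_sigmaType (past l n) -> _).
Proof. by apply: dmeas_ist => j; exact: measurable_lk. Qed.

Lemma integral_Y k u (h : Yt -> R) : measurable_fun setT h -> (forall y, 0 <= h y) ->
  (\int[P]_w (h (Y k l u w))%:E = \int[mu]_y (f l u i y * h y)%:E)%E.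
Proof.
move=> mh h0; case: sk => mY _ lawY _ _; case: (dens l u i) => mf f0 _.
by apply: integral_law => //; exact: lawY.
Qed.

Section supermartingale.
(** [phi m u] is the factor of a step at which [m] leads and [u] is drawn; [phi1] bounds its
    conditional mean under [h_i] by one. *)
Variable phi : 'I_M -> 'I_M -> Yt -> R.
Hypothesis mphi : forall m u, measurable_fun setT (phi m u).
Hypothesis phi0 : forall m u y, 0 <= phi m u y.
Hypothesis phi1 : forall m,
  (\sum_u (Q l m u)%:E * \int[mu]_y (f l u i y * phi m u y)%:E <= 1)%E.

(** Supermartingale inequality without conditional expectations: after splitting by leader and
    action, the past, the randomization and the new observation are independent, and [phi1] bounds
    the average over actions. *)
Lemma integral_step n (g : Om -> R) :
  measurable_fun (setT : set (src_sigmaType (past l n))) g -> (forall w, 0 <= g w) ->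
  (\int[P]_w (g w * phi (ist n w) (act n w) (Y n l (act n w) w))%:E <= \int[P]_w (g w)%:E)%E.
Proof.
move=> mg g0.
pose G m w := g w * \1_(ist n @^-1` [set m]) w.
pose A m u := sample d0 (Q l m) @^-1` [set u].
have mA m u : measurable (A m u) by exact: dmeas_sample.
have mG m : measurable_fun (setT : set (src_sigmaType (past l n))) (G m).
  apply: measurable_funM => //; apply: measurable_indic; exact: dmeas_istT.
have G0 m w : 0 <= G m w by rewrite mulr_ge0// indicE.
have mG' m : measurable_fun setT (G m) by exact: measurable_sig (mG m).
have sumG w : g w = \sum_m G m w.
  rewrite (bigD1 (ist n w))//= big1 ?addr0; first by rewrite /G indicE mem_set ?mulr1.
  by move=> m mi; rewrite /G indicE memNset ?mulr0//= => e; rewrite e eqxx in mi.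
have mU m u : measurable (U n l @^-1` A m u).
  by apply: (@sig_measurable [set (n, l, None)]); exact: sig_U.
have mW m u : measurable_fun setT (fun w => phi m u (Y n l u w)).
  apply: (@measurable_sig [set (n, l, Some u)]).
  exact: measurable_Y.
(* [integral_sigM] detaches first the observation, then the randomization, whose event has
   probability at most [Q l m u] by [sample_law]. *)
have term m u : (\int[P]_w (G m w * \1_(U n l @^-1` A m u) w * phi m u (Y n l u w))%:E <=
    \int[P]_w (G m w)%:E * ((Q l m u)%:E * \int[mu]_y (f l u i y * phi m u y)%:E))%E.
  rewrite (@integral_sigM (past l n `|` [set (n, l, None)]) [set (n, l, Some u)]) //.
  - rewrite (@integral_sigM (past l n) [set (n, l, None)])//.
    + rewrite -muleA; apply: lee_wpmul2l; first by apply: integral_ge0 => w _; rewrite lee_fin.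
      rewrite integral_Y//; apply: lee_wpmul2r.
        apply: integral_ge0 => y _; rewrite lee_fin mulr_ge0//.
        by case: (dens l u i).
      rewrite integral_indic// setIT.
      case: sk => _ _ _ lawU _; apply: (@le_trans _ _ (P (U n l @^-1` A m u))) => //.
      by rewrite lawU//; exact: sample_law.
    + by move=> x [_ xn] E; rewrite E ltnn in xn.
    + by apply: measurable_indic; exact: sig_U.
  - by move=> x [[_ xn]|->] // E; rewrite E ltnn in xn.
  - apply: measurable_funM; first by apply: measurable_sub (mG m) => x; left.
    by apply: measurable_indic; apply: sig_U => //; right.
  - exact: measurable_Y.
  - by move=> w; rewrite mulr_ge0// indicE.
have E w : g w * phi (ist n w) (act n w) (Y n l (act n w) w) =
    \sum_m \sum_u G m w * \1_(U n l @^-1` A m u) w * phi m u (Y n l u w).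
  rewrite (bigD1 (ist n w))//= [X in _ = _ + X]big1 ?addr0; last first.
    move=> m mi; apply: big1 => u _; rewrite /G indicE memNset ?mulr0 ?mul0r//=.
    by move=> e; rewrite e eqxx in mi.
  rewrite (bigD1 (act n w))//= big1 ?addr0; last first.
    move=> u ui; rewrite [X in _ * X * _]indicE memNset ?mulr0 ?mul0r//= => e.
    by rewrite -e /act eqxx in ui.
  by rewrite /G !indicE !mem_set ?mulr1.
under eq_integral do rewrite E -sumEFin.
have term0 m u w : (0 <= (G m w * \1_(U n l @^-1` A m u) w * phi m u (Y n l u w))%:E)%E.
  by rewrite lee_fin mulr_ge0// mulr_ge0// indicE.
have mterm m u : measurable_fun setT (fun w =>
    (G m w * \1_(U n l @^-1` A m u) w * phi m u (Y n l u w))%:E).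
  apply/measurable_EFinP; apply: measurable_funM => //.
  by apply: measurable_funM => //; exact: measurable_indic.
rewrite ge0_integral_sum//; last 2 first.
- by move=> m; under eq_fun do rewrite -sumEFin; apply: emeasurable_sum.
- by move=> m w _; rewrite -sumEFin sume_ge0.
under [leRHS]eq_integral do rewrite sumG -sumEFin.
rewrite ge0_integral_sum//; last 2 first.
- by move=> m; apply/measurable_EFinP.
- by move=> m w _; rewrite lee_fin.
apply: lee_sum => m _.
under eq_integral do rewrite -sumEFin.
rewrite ge0_integral_sum//.
apply: (@le_trans _ _ (\sum_u \int[P]_w (G m w)%:E *
   ((Q l m u)%:E * \int[mu]_y (f l u i y * phi m u y)%:E)))%E.
  by apply: lee_sum => u _; exact: term.
rewrite -ge0_sume_distrr; last first.
  move=> u _; rewrite mule_ge0//; first by rewrite lee_fin; case: (pmfQ l m).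
  by apply: integral_ge0 => y _; rewrite lee_fin mulr_ge0//; case: (dens l u i).
rewrite -[leRHS]mule1; apply: lee_wpmul2l => //.
by apply: integral_ge0 => w _; rewrite lee_fin.
Qed.

Fixpoint mprod (n : nat) (w : Om) : R :=
  if n is n'.+1 then mprod n' w * phi (ist n' w) (act n' w) (Y n' l (act n' w) w) else 1.

(** The product frozen once it reaches [x]: a crossing at any time up to [n] becomes an event at the
    single time [n]. *)
Fixpoint stopped_mprod (x : R) (n : nat) (w : Om) : R :=
  if n is n'.+1 then
    let z := stopped_mprod x n' w in
    if x <= z then z else z * phi (ist n' w) (act n' w) (Y n' l (act n' w) w)
  else 1.

Lemma stopped_mprod_ge0 x n w : 0 <= stopped_mprod x n w.
Proof. by elim: n => [|n IH] //=; case: ifP => // _; rewrite mulr_ge0. Qed.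

Lemma measurable_mprod n : measurable_fun (setT : set (src_sigmaType (past l n))) (mprod n).
Proof.
elim: n => [|n IH]; first exact: measurable_cst.
by apply: (measurable_step (g := phi)) => //; exact: dmeas_istT.
Qed.

Lemma stopped_mprodS x n w (A := stopped_mprod x n @^-1` `[x, +oo[%classic) :
  stopped_mprod x n.+1 w = stopped_mprod x n w * \1_A w +
    stopped_mprod x n w * \1_(~` A) w * phi (ist n w) (act n w) (Y n l (act n w) w).
Proof.
rewrite /= /A; case: ifPn => xz; rewrite !indicE in_setC.
  by rewrite mem_set ?mulr1 ?mulr0 ?mul0r ?addr0//= in_itv/= xz.
rewrite memNset ?mulr0 ?mulr1 ?add0r//= in_itv/= andbT; exact/negP.
Qed.

Lemma measurable_stopped_mprod x n :
  measurable_fun (setT : set (src_sigmaType (past l n))) (stopped_mprod x n).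
Proof.
elim: n => [|n IH]; first exact: measurable_cst.
rewrite (funext (stopped_mprodS x n)).
have mA : @measurable _ (src_sigmaType (past l n)) (stopped_mprod x n @^-1` `[x, +oo[%classic).
  exact: sig_preimage.
apply: measurable_funD.
  apply: (measurable_sub (past_sub (leqnSn n))); exact: measurable_funM.
apply: (measurable_step (g := phi)) => //; first exact: dmeas_istT.
apply: measurable_funM => //; apply: measurable_indic; exact: measurableC.
Qed.

Lemma integral_stopped_mprod x n : (\int[P]_w (stopped_mprod x n w)%:E <= 1)%E.
Proof.
elim: n => [|n IH].
  rewrite (eq_integral (cst 1%E))// integral_cst// mul1e.
  exact: probability_le1.
under eq_integral do rewrite stopped_mprodS.
set A := _ @^-1` _.
have mA : @measurable _ (src_sigmaType (past l n)) A.
  by apply: sig_preimage => //; exact: measurable_stopped_mprod.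
have mA' := sig_measurable mA.
have mz := @measurable_stopped_mprod x n; have mz' := measurable_sig mz.
have z0 := stopped_mprod_ge0 x n.
have m1 : measurable_fun (setT : set (src_sigmaType (past l n)))
    (fun w => stopped_mprod x n w * \1_(~` A) w).
  by apply: measurable_funM => //; apply: measurable_indic; exact: measurableC.
have m2 : measurable_fun setT (fun w => (stopped_mprod x n w * \1_A w)%:E).
  by apply/measurable_EFinP/measurable_funM => //; exact: measurable_indic.
have m3 : measurable_fun setT (fun w => (stopped_mprod x n w * \1_(~` A) w *
    phi (ist n w) (act n w) (Y n l (act n w) w))%:E).
  apply/measurable_EFinP; apply: (@measurable_sig (past l n.+1)).
  by apply: (measurable_step (g := phi)) => //; exact: dmeas_istT.
under eq_integral do rewrite EFinD.
rewrite ge0_integralD//; last 2 first.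
- by move=> w _; rewrite lee_fin mulr_ge0// indicE.
- by move=> w _; rewrite lee_fin mulr_ge0// mulr_ge0// indicE.
apply: le_trans IH.
apply: (@le_trans _ _ (\int[P]_w (stopped_mprod x n w * \1_A w)%:E +
   \int[P]_w (stopped_mprod x n w * \1_(~` A) w)%:E)%E).
  by apply: leeD => //; apply: integral_step => // w; rewrite mulr_ge0// indicE.
rewrite -ge0_integralD//; last 3 first.
- by move=> w _; rewrite lee_fin mulr_ge0// indicE.
- by move=> w _; rewrite lee_fin mulr_ge0// indicE.
- by apply/measurable_EFinP; exact: measurable_sig m1.
rewrite le_eqVlt; apply/orP; left; apply/eqP; apply: eq_integral => w _.
rewrite -EFinD -mulrDr !indicE in_setC; congr EFin.
by case: (_ \in _); rewrite ?addr0 ?add0r mulr1.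
Qed.

Lemma mprod_le_stopped x n k w : (k <= n)%N -> x <= mprod k w -> x <= stopped_mprod x n w.
Proof.
move=> kn xk.
suff : ((forall k, (k <= n)%N -> mprod k w < x) /\ stopped_mprod x n w = mprod n w)
    \/ x <= stopped_mprod x n w.
  by case => // -[/(_ _ kn)]; rewrite ltNge xk.
elim: n {kn} => [|n IH] /=.
  case: (leP x 1) => x1; [by right|left; split => // k'].
  by rewrite leqn0 => /eqP ->.
case: ifPn => [|xz]; first by right.
case: IH => [[h E]|]; last by rewrite (negPf xz).
rewrite E; case: (leP x (mprod n.+1 w)) => x1; [by right|left; split => // k'].
by rewrite leq_eqVlt => /predU1P[->//|]; rewrite ltnS; exact: h.
Qed.

Definition reach (x : R) : set Om := [set w | exists n, x <= mprod n w].

Lemma sig_reach x : src_sigma (sensor l) (reach x).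
Proof.
have -> : reach x = \bigcup_n (mprod n @^-1` `[x, +oo[%classic).
  apply/seteqP; split => [w [n h]|w [n _ h]]; exists n => //=;
    by move: h; rewrite /= in_itv/= andbT.
apply: (@bigcupT_measurable _ (src_sigmaType (sensor l))) => n.
apply: (@sig_sub (past l n)); first by move=> y [].
by apply: sig_preimage => //; exact: measurable_mprod.
Qed.

Lemma ville x : 0 < x -> (P (reach x) <= (x^-1)%:E)%E.
Proof.
move=> x0.
pose D n := stopped_mprod x n @^-1` `[x, +oo[%classic.
have mz n := measurable_sig (@measurable_stopped_mprod x n).
have mD n : measurable (D n).
  by apply: (@sig_measurable (past l n)); apply: sig_preimage => //; exact: measurable_stopped_mprod.
have PD n : (P (D n) <= (x^-1)%:E)%E.
  have : (x%:E * P (D n) <= 1)%E.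
    apply: le_trans (integral_stopped_mprod x n).
    rewrite -(setIT (D n)) -integral_indic// -ge0_integralZl//; last 2 first.
    - by apply/measurable_EFinP; exact: measurable_indic.
    - by rewrite lee_fin ltW.
    under eq_integral do rewrite -EFinM.
    apply: ge0_le_integral => //.
    - by move=> w _; rewrite lee_fin mulr_ge0 ?(ltW x0)// indicE.
    - by apply/measurable_EFinP; exact: measurable_funM.
    - exact/measurable_EFinP.
    - move=> w _; rewrite lee_fin indicE.
      case: (boolP (w \in D n)) => [|_]; last by rewrite mulr0 stopped_mprod_ge0.
      by rewrite inE /D /= in_itv/= andbT mulr1.
  have PDf : P (D n) \is a fin_num by exact: fin_num_measure.
  rewrite -(fineK PDf) -EFinM !lee_fin => h.
  by rewrite -[leRHS]mul1r ler_pdivlMr// mulrC.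
have sub : reach x `<=` \bigcup_n D n.
  move=> w [n h]; exists n => //; rewrite /D /= in_itv/= andbT.
  exact: (mprod_le_stopped (leqnn n)).
apply: (@le_trans _ _ (P (\bigcup_n D n))).
  apply: le_measure => //; rewrite inE; last exact: bigcupT_measurable.
  exact: sig_measurable (sig_reach x).
have ndD : nondecreasing_seq D.
  apply/nondecreasing_seqP => n; apply/subsetPset => w; rewrite /D /= !in_itv/= !andbT => h.
  by rewrite h.
have cv := nondecreasing_cvg_mu (mu := P) mD (bigcupT_measurable _ mD) ndD.
rewrite -(cvg_lim _ cv)//; apply: lime_le; first by apply/cvg_ex; eexists; exact: cv.
by apply: nearW => n; exact: PD.
Qed.

End supermartingale.

(** * Likelihood ratios and their tilted versions *)

Section ratio.

Definition LR (j : 'I_M) (n : nat) (w : Om) : R := lk j n w / lk i n w.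

Lemma LRS j n w : LR j n.+1 w =
  LR j n w * (f l (act n w) j (Y n l (act n w) w) / f l (act n w) i (Y n l (act n w) w)).
Proof. by rewrite /LR !lkS invfM mulrACA. Qed.

Lemma LR0 j w : LR j 0 w = 1.
Proof. by rewrite /LR !lk0 divr1. Qed.

Lemma lk_ge0 j n w : 0 <= lk j n w.
Proof. by apply: prodr_ge0 => x _; case: (dens l x.1 j). Qed.

Lemma LR_ge0 j n w : 0 <= LR j n w.
Proof. by rewrite divr_ge0 ?lk_ge0. Qed.

Lemma sig_LR_reach j x : src_sigma (sensor l) [set w | exists n, x <= LR j n w].
Proof.
pose phi (m u : 'I_M) y := f l u j y / f l u i y.
have mphi m u : measurable_fun setT (phi m u) by exact: (measurable_ratio (dens l u j) (dens l u i)).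
rewrite (_ : [set w | _] = reach phi x); first exact: sig_reach.
have E n w : LR j n w = mprod phi n w.
  by elim: n => [|n IH]; rewrite ?LR0// LRS IH.
by rewrite /reach; under [in RHS]eq_set do under eq_exists do rewrite -E.
Qed.

(** The step factor has mean at most one under [f l u i] for every action, hence under every action
    distribution. *)
Lemma LR_ville j x : 0 < x -> (P [set w | exists n, x <= LR j n w]%R <= (x^-1)%:E)%E.
Proof.
move=> x0.
pose phi (m u : 'I_M) y := f l u j y / f l u i y.
have mphi m u : measurable_fun setT (phi m u) by exact: (measurable_ratio (dens l u j) (dens l u i)).
have phi0 m u y : 0 <= phi m u y.
  by rewrite divr_ge0//; [case: (dens l u j)|case: (dens l u i)].
have E n w : LR j n w = mprod phi n w.
  by elim: n => [|n IH]; rewrite ?LR0// LRS IH.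
rewrite (_ : [set w | _] = reach phi x); last first.
  by rewrite /reach; under [in RHS]eq_set do under eq_exists do rewrite -E.
apply: ville => // m.
have [q0 q1] := pmfQ l m.
apply: (@le_trans _ _ (\sum_u (Q l m u)%:E)%E); last by rewrite sumEFin q1.
apply: lee_sum => u _; rewrite -[leRHS]mule1; apply: lee_wpmul2l; first by rewrite lee_fin.
have [mj j0 <-] := dens l u j; have [mi i0 _] := dens l u i.
apply: ge0_le_integral => //.
- by move=> y _; rewrite lee_fin mulr_ge0.
- by apply/measurable_EFinP; apply: measurable_funM.
- exact/measurable_EFinP.
(* Where [f l u i y = 0] the left side vanishes, so only the mass of [f l u j] on the support of
   [f l u i] is counted. *)
- move=> y _; rewrite lee_fin /phi mulrCA.
  have [->|h] := eqVneq (f l u i y) 0; first by rewrite mul0r mulr0.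
  by rewrite divff// mulr1.
Qed.

Definition visits (m : 'I_M) (n : nat) (w : Om) : nat := \sum_(k < n) (ist k w == m).

Lemma visitsS m n w : visits m n.+1 w = (visits m n w + (ist n w == m))%N.
Proof. by rewrite /visits big_ord_recr. Qed.

Lemma sum_visits n w : (\sum_m visits m n w)%N = n.
Proof.
elim: n => [|n IH]; first by rewrite big1// => m _; rewrite /visits big_ord0.
under eq_bigr do rewrite visitsS.
rewrite big_split /= IH (bigD1 (ist n w))//= eqxx big1 ?addn0 ?addn1// => m mi.
by rewrite eq_sym (negPf mi).
Qed.

Definition tilted (t b : R) (j m : 'I_M) (n : nat) (w : Om) : R :=
  LR j n w `^ t * expR (b * (visits m n w)%:R).

(** Each step led by [m0] earns a factor [expR b], paid for by the affinity averaged over [Q l m0];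
    at other steps nothing is earned and the affinity is at most one for every action. *)
Lemma tilted_ville t b j m0 x : 0 < t -> t < 1 -> 0 < x ->
  (\sum_u (Q l m0 u)%:E * aff mu t (f l u i) (f l u j) <= (expR (- b))%:E)%E ->
  measurable [set w | exists n, x <= tilted t b j m0 n w] /\
  (P [set w | exists n, x <= tilted t b j m0 n w]%R <= (x^-1)%:E)%E.
Proof.
move=> t0 t1 x0 hb.
pose e (m : 'I_M) := if m == m0 then expR b else 1.
have e0 m : 0 <= e m by rewrite /e; case: ifP => // _; exact: expR_ge0.
pose phi (m u : 'I_M) y := (f l u j y / f l u i y) `^ t * e m.
have mphi m u : measurable_fun setT (phi m u).
  apply: measurable_funM => //; apply: (measurableT_comp (@measurable_powR R t)).
  exact: (measurable_ratio (dens l u j) (dens l u i)).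
have phi0 m u y : 0 <= phi m u y by rewrite mulr_ge0 ?powR_ge0.
have E n w : tilted t b j m0 n w = mprod phi n w.
  elim: n => [|n IH].
    by rewrite /tilted LR0 powR1 /visits big_ord0 mulr0 expR0 mulr1.
  rewrite /= -IH /tilted LRS powRM ?LR_ge0//; last first.
    by rewrite divr_ge0//; [case: (dens l (act n w) j)|case: (dens l (act n w) i)].
  rewrite visitsS natrD mulrDr expRD /phi /e mulrACA; congr (_ * (_ * _)).
  by case: eqP => _; rewrite ?mulr1 ?mulr0 ?expR0.
have -> : [set w | exists n, x <= tilted t b j m0 n w] = reach phi x.
  by rewrite /reach; under [in RHS]eq_set do under eq_exists do rewrite -E.
split; first exact: sig_measurable (sig_reach mphi x).
apply: ville => // m.
have aff0 u := aff_ge0 t (dens l u i) (dens l u j).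
have [q0 q1] := pmfQ l m.
have Ephi u : (\int[mu]_y (f l u i y * phi m u y)%:E = (e m)%:E * aff mu t (f l u i) (f l u j))%E.
  rewrite /aff -ge0_integralZl//.
  - by apply: eq_integral => y _; rewrite -EFinM /phi; congr EFin; ring.
  - by apply/measurable_EFinP; exact: measurable_tilt.
  - move=> y _; rewrite lee_fin mulr_ge0 ?powR_ge0//; by case: (dens l u i).
  - by rewrite lee_fin.
under eq_bigr do rewrite Ephi.
rewrite /e; case: eqP => [->|_].
  under eq_bigr do rewrite muleCA.
  rewrite -ge0_sume_distrr; last by move=> u _; rewrite mule_ge0// lee_fin; case: (pmfQ l m0).
  apply: (@le_trans _ _ ((expR b)%:E * (expR (- b))%:E)%E).
    by apply: lee_wpmul2l => //; rewrite lee_fin expR_ge0.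
  by rewrite -EFinM -expRD subrr expR0.
apply: (@le_trans _ _ (\sum_u (Q l m u)%:E)%E); last by rewrite sumEFin q1.
apply: lee_sum => u _; rewrite mul1e -[leRHS]mule1; apply: lee_wpmul2l; first by rewrite lee_fin.
exact: aff_le1.
Qed.

End ratio.
End one_sensor.
End process.

(** * Chernoff rates *)

Lemma finite_pos_lbound {R : realType} (A : finType) (p : pred A) (F : A -> R) :
  (forall a, p a -> 0 < F a) -> exists2 c, 0 < c & forall a, p a -> c <= F a.
Proof.
move=> F0; exists (\big[Num.min/1]_(a | p a) F a); first exact: lt_bigmin.
by move=> a pa; exact: bigmin_le_cond.
Qed.

Section rates.
Context {R : realType} {L M : nat} {dY} {Yt : measurableType dY} (mu : {measure set Yt -> \bar R}).
Variables (f : 'I_L -> 'I_M -> 'I_M -> Yt -> R) (Q : 'I_L -> 'I_M -> 'I_M -> R).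
Hypothesis hM : (1 < M)%N.
Hypothesis dens : forall l u i, is_density mu (f l u i).
Hypothesis klfin : forall l u i j, (KL mu (f l u i) (f l u j) < +oo)%E.
Hypothesis klpos : forall l (i j : 'I_M), i != j -> exists u, (0 < KL mu (f l u i) (f l u j))%E.
Hypothesis secfin : forall l u i j,
  (\int[mu]_y (f l u i y * (ln (f l u i y / f l u j y)) ^+ 2)%:E < +oo)%E.
Hypothesis optQ : forall l i, is_pmf (Q l i) /\
  forall q : 'I_M -> R, is_pmf q -> Jobj mu f l i q <= Jobj mu f l i (Q l i).

Lemma Dr_ge0 l u i j : 0 <= Dr mu f l u i j.
Proof. by apply: fine_ge0; apply: KL_ge0. Qed.

Lemma exists_other (m : 'I_M) : exists j : 'I_M, j != m.
Proof.
case: M hM m => [//|[//|k]] _ m.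
have [->|m0] := eqVneq m ord0; first by exists ord_max.
by exists ord0; rewrite eq_sym.
Qed.

Lemma Jobj_le l m (q : 'I_M -> R) j : is_pmf q -> j != m ->
  Jobj mu f l m q <= \sum_u q u * Dr mu f l u m j.
Proof.
move=> [q0 _] jm; apply: ge_inf; last by exists j.
by exists 0 => _ [k _ <-]; apply: sumr_ge0 => u _; rewrite mulr_ge0// Dr_ge0.
Qed.

Lemma vval_le l m j : j != m -> vval mu f l m <= \sum_u Q l m u * Dr mu f l u m j.
Proof.
move=> jm; have [pQ oQ] := optQ l m.
apply: le_trans (Jobj_le l pQ jm); apply: ge_sup.
  by exists (Jobj mu f l m (Q l m)); exists (Q l m).
by move=> _ [q pq <-]; exact: oQ.
Qed.

(** The uniform pmf already has a positive objective: some action separates each pair of hypotheses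
    and all divergences are nonnegative. *)
Lemma vval_gt0 l m : 0 < vval mu f l m.
Proof.
have [pQ oQ] := optQ l m.
pose q (u : 'I_M) : R := M%:R^-1.
have M0 : (0 : R) < M%:R by rewrite ltr0n ltnW.
have pq : is_pmf q.
  split => [u|]; first by rewrite invr_ge0 ltW.
  by rewrite sumr_const card_ord -[LHS]mulr_natl divff// gt_eqF.
have [c c0 hc] : exists2 c, 0 < c & forall j, j != m -> c <= \sum_u q u * Dr mu f l u m j.
  apply: finite_pos_lbound => j jm.
  have [u Du] : exists u, (0 < KL mu (f l u m) (f l u j))%E by apply: klpos; rewrite eq_sym.
  rewrite (bigD1 u)//=; apply: ltr_pwDl.
    rewrite mulr_gt0 ?invr_gt0//; apply: fine_gt0; rewrite Du.
    exact: klfin.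
  by apply: sumr_ge0 => u' _; rewrite mulr_ge0 ?Dr_ge0// invr_ge0 ltW.
apply: (lt_le_trans c0); apply: (@le_trans _ _ (Jobj mu f l m q)).
  apply: lb_le_inf; first by have [j jm] := exists_other m; eexists; exists j; first exact: jm.
  by move=> _ [j jm <-]; exact: hc.
apply: ub_le_sup; last by exists q.
by exists (Jobj mu f l m (Q l m)) => _ [q' pq' <-]; exact: oQ.
Qed.

Lemma Iinfo_gt0 i : (0 < L)%N -> 0 < Iinfo mu f i.
Proof.
move=> hL; rewrite /Iinfo (bigD1 (Ordinal hL))//=; apply: ltr_pwDl; first exact: vval_gt0.
by apply: sumr_ge0 => l _; exact/ltW/vval_gt0.
Qed.

Lemma sum_rho i : (0 < L)%N -> \sum_(l < L) rho mu f l i = 1.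
Proof. by move=> hL; rewrite -mulr_suml divff// gt_eqF// Iinfo_gt0. Qed.

(** Averaging [aff_le] over [Q l m] gives a drift of at least [vval mu f l m] against every [j], and
    [1 + x <= expR x] concludes. *)
Lemma chernoff_rate : exists2 C : R, 0 < C & forall l m j t, j != m -> 0 < t -> t <= 2^-1 ->
  (\sum_u (Q l m u)%:E * aff mu t (f l u m) (f l u j)
     <= (expR (- (t * vval mu f l m - C * t ^+ 2)))%:E)%E.
Proof.
pose S l u i j := 2 * fine (\int[mu]_y (f l u i y * (ln (f l u i y / f l u j y)) ^+ 2)%:E)%E.
have S0 l u i j : 0 <= S l u i j.
  rewrite mulr_ge0// fine_ge0// integral_ge0// => y _.
  by rewrite lee_fin mulr_ge0 ?sqr_ge0//; case: (dens l u i).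
pose x4 := ('I_L * 'I_M * 'I_M * 'I_M)%type.
(* The sum over all index tuples dominates each second-moment constant, so one [C] serves all of
   them. *)
pose C := \sum_(x : x4) S x.1.1.1 x.1.1.2 x.1.2 x.2 + 64.
have SC l u i j : S l u i j + 64 <= C.
  rewrite lerD2r (bigD1 ((l, u, i, j) : x4))//= lerDl; apply: sumr_ge0 => x _; exact: S0.
exists C; first by apply: ltr_wpDl => //; apply: sumr_ge0 => x _; exact: S0.
move=> l m j t jm t0 t2; have [[q0 q1] _] := optQ l m.
apply: (@le_trans _ _ (\sum_u (Q l m u * (1 - t * Dr mu f l u m j + C * t ^+ 2))%:E)%E).
  apply: lee_sum => u _; rewrite EFinM; apply: lee_wpmul2l; first by rewrite lee_fin.
  apply: le_trans (aff_le (dens l u m) (dens l u j) (klfin l u m j) (secfin l u m j) t0 t2) _.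
  by rewrite lee_fin lerD2l ler_wpM2r ?sqr_ge0//; exact: SC.
rewrite sumEFin lee_fin.
rewrite (eq_bigr (fun u => Q l m u * (1 + C * t ^+ 2) - t * (Q l m u * Dr mu f l u m j))); last first.
  by move=> u _; ring.
rewrite sumrB -mulr_suml q1 mul1r -mulr_sumr.
have v := vval_le l jm.
apply: le_trans (expR_ge1Dx _).
by have := ler_wpM2l (ltW t0) v; lra.
Qed.

End rates.

(** * Exponentially small sequences *)

Section exp_small.
Context {R : realType}.
Implicit Types a b : nat -> \bar R.

Definition exp_small a := exists K b : R, [/\ 0 <= K, 0 < b &
  forall n, (a n <= (K * expR (- (b * n%:R)))%:E)%E].

Lemma exp_small_le a b : (forall n, a n <= b n)%E -> exp_small b -> exp_small a.
Proof.
move=> ab [K [c [K0 c0 h]]]; exists K, c; split => // n; exact: le_trans (ab n) (h n).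
Qed.

Lemma exp_small_expR (K b : R) : 0 <= K -> 0 < b -> exp_small (fun n => (K * expR (- (b * n%:R)))%:E).
Proof. by move=> K0 b0; exists K, b. Qed.

Lemma exp_small0 : exp_small (fun=> 0%E).
Proof. by exists 0, 1; split => // n; rewrite mul0r. Qed.

Lemma exp_smallD a b : exp_small a -> exp_small b -> exp_small (fun n => (a n + b n)%E).
Proof.
move=> [K1 [b1 [K10 b10 h1]]] [K2 [b2 [K20 b20 h2]]].
exists (K1 + K2), (Num.min b1 b2); split; first exact: addr_ge0.
  by rewrite lt_min b10.
move=> n; rewrite mulrDl EFinD; apply: leeD.
  apply: le_trans (h1 n) _; rewrite lee_fin ler_wpM2l// ler_expR lerN2 ler_wpM2r//.
  by rewrite ge_min lexx.
apply: le_trans (h2 n) _; rewrite lee_fin ler_wpM2l// ler_expR lerN2 ler_wpM2r//.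
by rewrite ge_min lexx orbT.
Qed.

Lemma exp_small_sum (A : Type) (s : seq A) (p : pred A) (F : A -> nat -> \bar R) :
  (forall x, p x -> exp_small (F x)) -> exp_small (fun n => \sum_(x <- s | p x) F x n)%E.
Proof.
move=> hF; elim: s => [|x s IH].
  by apply: exp_small_le exp_small0 => n; rewrite big_nil.
case: (boolP (p x)) => px.
  apply: exp_small_le (exp_smallD (hF _ px) IH) => n.
  by rewrite big_cons px.
by apply: exp_small_le IH => n; rewrite big_cons (negPf px).
Qed.

Lemma exp_small_powR_summable a (r : R) : (forall n, 0 <= a n)%E -> 0 < r -> exp_small a ->
  (\sum_(n <oo) (n.+1%:R `^ r)%:E * a n < +oo)%E.
Proof.
move=> a0 r0 [K [b [K0 b0 h]]].
(* [ln x <= x] applied to [s (n+1)] turns the polynomial weight into a slower exponential *)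
pose s := b / 2 / r; have s0 : 0 < s by rewrite !divr_gt0.
have lnle (z : R) : 0 < z -> ln z <= z.
  move=> z0; apply: (@le_trans _ _ (z - 1)); last by rewrite gerBl.
  by have := @le_ln1Dx _ (z - 1); rewrite addrCA subrr addr0; apply; lra.
have pw n : (n.+1%:R : R) `^ r <= expR (r * (s - ln s)) * expR (b / 2 * n%:R).
  have n0 : (0 : R) < n.+1%:R by rewrite ltr0n.
  have sn0 : 0 < s * n.+1%:R by rewrite mulr_gt0.
  have l1 := lnle _ sn0.
  rewrite -expRD /powR gt_eqF// ler_expR.
  rewrite lnM ?posrE// in l1.
  have -> : b / 2 * n%:R = r * (s * n%:R).
    by rewrite /s; field; rewrite gt_eqF.
  rewrite -mulrDr ler_wpM2l ?(ltW r0)//.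
  have E : s * n.+1%:R = s * n%:R + s by rewrite -natr1; ring.
  by rewrite E in l1; lra.
pose x := expR (- (b / 2)); pose C := expR (r * (s - ln s)) * K.
have x1 : x < 1 by rewrite -expR0 ltr_expR; lra.
have C0 : 0 <= C by rewrite mulr_ge0 ?expR_ge0.
have tm n : ((n.+1%:R `^ r)%:E * a n <= (C * x ^+ n)%:E)%E.
  apply: (@le_trans _ _ ((n.+1%:R `^ r)%:E * (K * expR (- (b * n%:R)))%:E)%E).
    by apply: lee_wpmul2l => //; rewrite lee_fin powR_ge0.
  rewrite -EFinM lee_fin.
  apply: (@le_trans _ _ (expR (r * (s - ln s)) * expR (b / 2 * n%:R) * (K * expR (- (b * n%:R))))).
    by rewrite ler_wpM2r// mulr_ge0 ?expR_ge0.
  rewrite mulrACA -/C -expRD /x -expRM_natl ler_wpM2l// ler_expR.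
  lra.
have part n : (\sum_(0 <= k < n) (k.+1%:R `^ r)%:E * a k <= (C / (1 - x))%:E)%E.
  apply: (@le_trans _ _ (\sum_(0 <= k < n) (C * x ^+ k)%:E)%E); first exact: lee_sum.
  rewrite sumEFin lee_fin -mulr_sumr ler_wpM2l//.
  rewrite -[leRHS]mul1r ler_pdivlMr ?subr_gt0//.
  suff -> : (\sum_(0 <= k < n) x ^+ k) * (1 - x) = 1 - x ^+ n.
    by rewrite gerBl exprn_ge0// expR_ge0.
  elim: n => [|n IH]; first by rewrite big_geq// mul0r expr0 subrr.
  by rewrite big_nat_recr//= mulrDl IH exprS; ring.
apply: (@le_lt_trans _ _ (C / (1 - x))%:E); last by rewrite ltry.
apply: lime_le; last by apply: nearW => n; exact: part.
by apply: is_cvg_nneseries => n _ _; rewrite mule_ge0// lee_fin powR_ge0.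
Qed.

End exp_small.

(** * Exponentially small failure probabilities *)

Lemma measure_bigsetU_le {R : realType} {d} {T : measurableType d}
    (mu : {measure set T -> \bar R}) (A : Type) (s : seq A) (p : pred A) (F : A -> set T) :
  (forall x, p x -> measurable (F x)) ->
  (mu (\big[setU/set0]_(x <- s | p x) F x) <= \sum_(x <- s | p x) mu (F x))%E.
Proof.
move=> mF; elim: s => [|x s IH]; first by rewrite !big_nil measure0.
rewrite !big_cons; case: ifPn => // px.
apply: le_trans (leeD2l _ IH).
by apply: measureU2; [exact: mF|exact: bigsetU_measurable].
Qed.

Lemma argmaxIP {R : realType} (M : nat) (d0 : 'I_M) (F : 'I_M -> R) j :
  F j <= F (argmaxI d0 F).
Proof.
rewrite /argmaxI; case: pickP => [k /forallP //|none].
case: (@arg_maxP _ _ _ d0 xpredT F isT) => k _ hk.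
by have /negbT/forallPn[m /negP[]] := none k; exact: hk.
Qed.

Lemma argmaxI_eq {R : realType} (M : nat) (d0 : 'I_M) (F : 'I_M -> R) i :
  (forall j, j != i -> F j < F i) -> argmaxI d0 F = i.
Proof.
move=> h; apply/eqP; apply: contraT => /h.
by rewrite ltNge argmaxIP.
Qed.

Section failure.
Context {R : realType} {L M : nat} {dY} {Yt : measurableType dY} (mu : {measure set Yt -> \bar R}).
Variables (f : 'I_L -> 'I_M -> 'I_M -> Yt -> R) (Q : 'I_L -> 'I_M -> 'I_M -> R) (d0 : 'I_M).
Context {dO} {Om : measurableType dO} (P : probability Om R).
Variables (Y : nat -> 'I_L -> 'I_M -> Om -> Yt) (U : nat -> 'I_L -> Om -> R) (i : 'I_M).
Hypothesis dens : forall l u i, is_density mu (f l u i).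
Hypothesis pmfQ : forall l m, is_pmf (Q l m).
Hypothesis sk : skeleton P mu (fun l u => f l u i) Y U.
Variable l : 'I_L.

Local Notation lk := (lk f Q d0 Y U l).
Local Notation LR := (LR f Q d0 Y U i l).
Local Notation ist := (ist f Q d0 Y U l).
Local Notation act := (act f Q d0 Y U l).
Local Notation nvis := (visits f Q d0 Y U l).
Local Notation tlt := (tilted f Q d0 Y U i l).

Lemma measurable_lkT j n : measurable_fun setT (lk j n).
Proof. by apply: (measurable_sig sk); exact: measurable_lk. Qed.

Lemma measurable_LR j n : measurable_fun setT (LR j n).
Proof.
apply: measurable_funM; first exact: measurable_lkT.
by apply: measurable_funV_ge0; [exact: measurable_lkT|move=> w; exact: (lk_ge0 Q d0 Y U dens)].
Qed.

(* Ratios by [lk i] are junk ([x / 0 = 0]) on this event. *)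
Lemma lk_eq0_negligible n : P.-negligible [set w | lk i n w = 0].
Proof.
elim: n => [|n IH].
  apply: negligibleS (negligible_set0 P) => w /=; rewrite lk0 => /eqP.
  by rewrite oner_eq0.
pose N u := Y n l u @^-1` (f l u i @^-1` [set 0]).
have N0 u : P.-negligible (N u).
  have mf : measurable (f l u i @^-1` [set 0]).
    by rewrite -[X in measurable X]setTI; case: (dens l u i) => + _ _; apply.
  case: sk => mY _ lawY _ _; exists (N u); split => //.
    by rewrite -[X in measurable X]setTI; exact: mY.
  rewrite lawY// -(integral0 mu (f l u i @^-1` [set 0])).
  by apply: eq_integral => y; rewrite inE => /= ->.
apply: (negligibleS (A := [set w | lk i n w = 0] `|` \big[setU/set0]_(u : 'I_M) N u)).
  move=> w /=; rewrite lkS => /eqP; rewrite mulf_eq0 => /orP[/eqP ->|/eqP h]; [by left|right].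
  by rewrite -bigcup_seq; exists (act n w); rewrite //= mem_index_enum.
apply: negligibleU => //.
by elim/big_ind: _ => //; [exact: negligible_set0|move=> A B; exact: negligibleU].
Qed.

Lemma lk_neq0 k n w : (k <= n)%N -> lk i n w != 0 -> lk i k w != 0.
Proof.
elim: n => [|n IH]; first by rewrite leqn0 => /eqP ->.
rewrite leq_eqVlt => /predU1P[->//|kn].
by rewrite lkS mulf_eq0 negb_or => /andP[h _]; exact: IH.
Qed.

(** The leader's posterior is at least that of [i], and both have the same positive
    normalization. *)
Lemma LR_leader k m w : lk i k w != 0 -> ist k w = m -> 1 <= LR m k w.
Proof.
move=> h <-; have lki : 0 < lk i k w by rewrite lt_def h (lk_ge0 Q d0 Y U dens).
rewrite ler_pdivlMr// mul1r.
have S0 : 0 < \sum_m lk m k w.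
  rewrite (bigD1 i)//=; apply: ltr_pwDl => //; apply: sumr_ge0 => j _.
  exact: (lk_ge0 Q d0 Y U dens).
have := argmaxIP d0 (post f l (hist d0 f Q Y U l w k)) i.
by rewrite /post ler_pM2r// invr_gt0.
Qed.

(** The count grows only at a visit, so it exceeds by at most one its value just before the last
    visit. *)
Lemma visits_le m n w (D : R) : 0 <= D ->
  (forall k, (k < n)%N -> ist k w = m -> (nvis m k w)%:R <= D) ->
  (nvis m n w)%:R <= D + 1.
Proof.
move=> D0; elim: n => [|n IH] h.
  by rewrite /visits big_ord0; lra.
rewrite visitsS natrD; case: eqP => [e|_].
  by rewrite lerD2r; exact: h.
by rewrite addr0; apply: IH => k kn; apply: h; rewrite ltnS ltnW.
Qed.

(** [v m] stands for [vval mu f l m], and [rate] for the bound of [chernoff_rate] at this sensor. *)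
Variables (C : R) (v : 'I_M -> R).
Hypotheses (C0 : 0 < C) (v0 : forall m, 0 < v m).
Hypothesis rate : forall m j t, j != m -> 0 < t -> t <= 2^-1 ->
  (\sum_u (Q l m u)%:E * aff mu t (f l u m) (f l u j)
     <= (expR (- (t * v m - C * t ^+ 2)))%:E)%E.

(** For [t <= k * v m / C] the quadratic loss is at most the fraction [k] of the linear gain. *)
Lemma rate_param (m : 'I_M) (k : R) : 0 < k -> exists t : R,
  [/\ 0 < t, t <= 2^-1 & t * v m - C * t ^+ 2 >= (1 - k) * (t * v m)].
Proof.
move=> k0; exists (Num.min (2^-1) (k * v m / C)); set t := Num.min _ _.
have t0 : 0 < t by rewrite /t lt_min invr_gt0 ltr0n/= divr_gt0// mulr_gt0.
have t1 : t <= k * v m / C by rewrite /t ge_min lexx orbT.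
split => //; first by rewrite /t ge_min lexx.
rewrite ler_pdivlMr// in t1.
have : t * (t * C) <= t * (k * v m) by rewrite ler_pM2l.
lra.
Qed.

Section event.
Variables (j : 'I_M) (eta : R).
Hypotheses (ji : j != i) (eta0 : 0 < eta) (eta1 : eta < 1).

(** The factor [n.+1] anticipates the moment bound, where stopping at [n.+1] is charged to a failure
    at [n]. The null event is included because [LR] is junk there. *)
Definition fail_event (n : nat) : set Om :=
  [set w | lk i n w = 0] `|` [set w | expR (- (eta * v i * n.+1%:R)) < LR j n w].

Lemma measurable_fail_event n : measurable (fail_event n).
Proof.
apply: measurableU.
  have := measurable_lkT i n (measurableT) (measurable_set1 (0 : R)).
  by rewrite setTI.
have := measurable_LR j n measurableT (measurable_itv `](expR (- (eta * v i * n.+1%:R))), +oo[).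
rewrite setTI; congr measurable.
by apply/seteqP; split => w /=; rewrite in_itv/= andbT.
Qed.

(** Outside the events [A2] no wrong hypothesis leads often, so [i] leads at nearly all steps; on
    failure the bonus then lifts the tilted ratio of [j] above the level of [A3]. Ville's inequality
    bounds both kinds of events. *)
Lemma fail_event_exp_small : exp_small (fun n => P (fail_event n)).
Proof.
have eta0' := eta0; have eta1' := eta1.
(* With [eta = 1 - 4 * k0], the coefficient [(1 - k0) ^+ 2 - eta - 2 * k0] of [n] in the final
   comparison is exactly [k0 ^+ 2]. *)
pose k0 := (1 - eta) / 4.
have k00 : 0 < k0 by rewrite /k0; lra.
have k01 : k0 < 1 by rewrite /k0; lra.
have M0 : (0 : R) < M%:R by rewrite ltr0n; case: (M) i => // -[].
(* All wrong hypotheses together then lead at most [k0 * n + M] of the first [n] steps. *)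
pose delta := k0 / M%:R.
have delta0 : 0 < delta by rewrite divr_gt0.
have [t3 [t30 t32 ht3]] := rate_param i k00.
pose b3 := (1 - k0) * (t3 * v i).
have b30 : 0 <= b3.
  by rewrite mulr_ge0//; [rewrite /k0; lra|rewrite mulr_ge0 ?(ltW (v0 i))// ltW].
have /choice[t2 ht2] : forall m, exists t : R,
  [/\ 0 < t, t <= 2^-1 & t * v m - C * t ^+ 2 >= (1 - 2^-1) * (t * v m)].
  by move=> m; apply: rate_param; rewrite invr_gt0.
pose b2 m := 2^-1 * (t2 m * v m).
have b20 m : 0 < b2 m.
  by have [t20 _ _] := ht2 m; rewrite /b2 mulr_gt0 ?invr_gt0// mulr_gt0.
pose q := t3 * v i.
have q0 : 0 < q by rewrite mulr_gt0.
(* The [1] absorbs the passage from [n] to [n.+1] in [fail_event], and [M] the extra visit per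
   hypothesis in [visits_le]. *)
pose x3 n := expR (q * (2 * k0 * n%:R - (1 + M%:R))).
pose A3 n := [set w | exists k, x3 n <= tlt t3 b3 j i k w].
pose x2 m n := expR (b2 m * (delta * n%:R)).
pose A2 m n := [set w | exists k, x2 m n <= tlt (1 - t2 m) (b2 m) m m k w].
have A3P n : measurable (A3 n) /\ (P (A3 n) <= ((x3 n)^-1)%:E)%E.
  apply: (tilted_ville d0 dens pmfQ sk) => //; first lra.
    exact: expR_gt0.
  apply: le_trans (rate ji t30 t32) _.
  by rewrite lee_fin ler_expR lerN2.
have A2P m n : m != i -> measurable (A2 m n) /\ (P (A2 m n) <= ((x2 m n)^-1)%:E)%E.
  move=> mi; have [t20 t22 h2] := ht2 m.
  apply: (tilted_ville d0 dens pmfQ sk); [lra|lra|exact: expR_gt0|].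
  have t21 : t2 m < 1 by lra.
  (* The exponent [1 - t2 m] under [h_i] becomes [t2 m] under [h_m], where [rate] applies because
     [Q l m] is the distribution used while [m] leads. *)
  under eq_bigr do rewrite affC//.
  apply: le_trans (rate _ t20 t22) _; first by rewrite eq_sym.
  by rewrite lee_fin ler_expR lerN2; apply: le_trans h2; rewrite /b2; lra.
have sub n : fail_event n `<=` [set w | lk i n w = 0] `|`
    (A3 n `|` \big[setU/set0]_(m | m != i) A2 m n).
  move=> w; have [h|h] := eqVneq (lk i n w) 0; first by left.
  case=> [/eqP|/= hLR]; first by rewrite (negPf h).
  right; have [hA|hA] := pselect ((\big[setU/set0]_(m | m != i) A2 m n) w); [by right|left].
  (* At a step led by [m] the ratio is at least one, so the tilted value is at least its bonus; too
     many visits would put [w] in [A2 m n]. *)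
  have vis m : m != i -> (nvis m n w)%:R <= delta * n%:R + 1.
    move=> mi; apply: visits_le; first by rewrite mulr_ge0// ltW.
    move=> k kn ik; rewrite leNgt; apply/negP => hk; apply: hA.
    rewrite -bigcup_seq_cond; exists m; first by rewrite /= mem_index_enum.
    exists k; rewrite /tilted.
    have L1 := LR_leader (lk_neq0 (ltnW kn) h) ik.
    have [t20 t22 _] := ht2 m.
    apply: (@le_trans _ _ (expR (b2 m * (nvis m k w)%:R))).
      by rewrite ler_expR ler_pM2l// ltW.
    rewrite ler_peMl ?expR_ge0//.
    rewrite -[leLHS](powRr0 (LR m k w)); apply: ler_powR => //; lra.
  have visi : n%:R - M%:R * (delta * n%:R + 1) <= (nvis i n w)%:R.
    rewrite lerBlDr -{1}(sum_visits f Q d0 Y U l n w) (bigD1 i)//= natrD lerD2l.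
    rewrite natr_sum; apply: (@le_trans _ _ (\sum_(m : 'I_M | m != i) (delta * n%:R + 1))).
      by apply: ler_sum.
    apply: (@le_trans _ _ (\sum_(m : 'I_M) (delta * n%:R + 1))).
      by rewrite [leRHS](bigD1 i)//= lerDr addr_ge0// mulr_ge0// ltW.
    by rewrite sumr_const card_ord mulr_natl.
  exists n; rewrite /tilted.
  have e1 : expR (- (eta * v i * n.+1%:R)) `^ t3 <= LR j n w `^ t3.
    by apply: ge0_ler_powR; rewrite ?nnegrE ?expR_ge0 ?ltW//; exact: (lt_trans (expR_gt0 _) hLR).
  apply: (@le_trans _ _ (expR (- (eta * v i * n.+1%:R)) `^ t3 * expR (b3 * (nvis i n w)%:R))); last first.
    by rewrite ler_wpM2r ?expR_ge0.
  rewrite -expRM -expRD /x3 ler_expR.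
  apply: (@le_trans _ _ (- (eta * v i * n.+1%:R) * t3 + b3 * (n%:R - M%:R * (delta * n%:R + 1)))); last first.
    by rewrite lerD2l ler_wpM2l.
  have -> : - (eta * v i * n.+1%:R) * t3 + b3 * (n%:R - M%:R * (delta * n%:R + 1)) =
      q * (- (eta * (n%:R + 1)) + (1 - k0) * (n%:R - k0 * n%:R - M%:R)).
    rewrite -natr1 /b3 /q /delta; field; exact: lt0r_neq0.
  rewrite ler_pM2l// -subr_ge0.
  have -> : - (eta * (n%:R + 1)) + (1 - k0) * (n%:R - k0 * n%:R - M%:R) - (2 * k0 * n%:R - (1 + M%:R))
     = n%:R * ((1 - k0) ^+ 2 - eta - 2 * k0) + (1 - eta) + k0 * M%:R by ring.
  rewrite addr_ge0//; last by rewrite mulr_ge0// ltW.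
  rewrite addr_ge0//; last by lra.
  rewrite mulr_ge0//.
  have -> : (1 - k0) ^+ 2 - eta - 2 * k0 = k0 ^+ 2.
    by rewrite /k0; field.
  exact: sqr_ge0.
have small : exp_small (fun n => ((x3 n)^-1)%:E + \sum_(m | m != i) ((x2 m n)^-1)%:E)%E.
  apply: exp_smallD.
    apply: exp_small_le (exp_small_expR (K := expR (q * (1 + M%:R))) (b := q * (2 * k0)) _ _).
    - move=> n; rewrite -expRN -expRD lee_fin ler_expR.
      by rewrite le_eqVlt; apply/orP; left; apply/eqP; ring.
    - exact: expR_ge0.
    - by rewrite mulr_gt0// mulr_gt0.
  apply: exp_small_sum => m _.
  apply: exp_small_le (exp_small_expR (K := 1) (b := b2 m * delta) _ _) => //.
  - by move=> n; rewrite -expRN mul1r lee_fin ler_expR mulrA.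
  - by rewrite mulr_gt0.
apply: exp_small_le small => n.
have [N [mN N0 hN]] := lk_eq0_negligible n.
have mA2 : measurable (\big[setU/set0]_(m | m != i) A2 m n).
  by apply: bigsetU_measurable => m mi; case: (A2P m n mi).
have [mA3 PA3] := A3P n.
apply: (@le_trans _ _ (P (N `|` (A3 n `|` \big[setU/set0]_(m | m != i) A2 m n)))).
  apply: le_measure; rewrite ?inE; [exact: measurable_fail_event| |].
    by apply: measurableU => //; exact: measurableU.
  by apply: (subset_trans (sub n)); apply: setUSS.
apply: (@le_trans _ _ (P N + P (A3 n `|` \big[setU/set0]_(m | m != i) A2 m n))%E).
  by apply: measureU2 => //; exact: measurableU.
rewrite [X in (X + _)%E](_ : _ = 0%E)// add0e.
apply: (@le_trans _ _ (P (A3 n) + P (\big[setU/set0]_(m | m != i) A2 m n))%E).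
  exact: measureU2.
apply: leeD => //.
apply: (@le_trans _ _ (\sum_(m | m != i) P (A2 m n))%E).
  apply: measure_bigsetU_le.
  by move=> m mi; case: (A2P m n mi).
by apply: lee_sum => m mi; case: (A2P m n mi).
Qed.

End event.
End failure.

(** * Decisions and error probability *)

Section decision.
Context {R : realType} {L M : nat} {dY} {Yt : measurableType dY} (mu : {measure set Yt -> \bar R}).
Variables (f : 'I_L -> 'I_M -> 'I_M -> Yt -> R) (Q : 'I_L -> 'I_M -> 'I_M -> R) (d0 : 'I_M).
Context {dO} {Om : measurableType dO} (P : probability Om R).
Variables (Y : nat -> 'I_L -> 'I_M -> Om -> Yt) (U : nat -> 'I_L -> Om -> R) (i : 'I_M).
Hypothesis dens : forall l u i, is_density mu (f l u i).
Hypothesis pmfQ : forall l m, is_pmf (Q l m).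
Hypothesis sk : skeleton P mu (fun l u => f l u i) Y U.
Variables (rh : 'I_L -> 'I_M -> R) (c : R).

Local Notation H l w n := (hist d0 f Q Y U l w n).
Local Notation lk := (lk f Q d0 Y U).
Local Notation LR := (LR f Q d0 Y U i).
Local Notation dec := (last_dec d0 f Q rh c Y U).
Local Notation stop := (stopped d0 f Q rh c Y U).
Local Notation N := (Nstop d0 f Q rh c Y U).

Lemma measurable_post l j n : measurable_fun setT (fun w => post f l (H l w n) j).
Proof.
apply: measurable_funM; first exact: (measurable_lkT Q d0 dens sk).
apply: measurable_funV_ge0.
  by apply: measurable_sum => m; exact: (measurable_lkT Q d0 dens sk).
by move=> w; apply: sumr_ge0 => m _; exact: (lk_ge0 Q d0 Y U dens).
Qed.

Lemma dmeas_istar l n : dmeas (fun w => istar d0 f l (H l w n)).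
Proof. by apply: dmeas_argmaxI => j; exact: measurable_post. Qed.

Lemma dmeas_local_ok l n : dmeas (fun w => local_ok d0 f rh c l (H l w n)).
Proof.
apply: (dmeas_select (h := fun m w => expR (rh l m * `|ln c|) *
  \big[Num.max/0]_(j | j != m) post f l (H l w n) j <= post f l (H l w n) m)).
  exact: dmeas_istar.
move=> m; apply: dmeas_ler; last exact: measurable_post.
apply: measurable_funM; first exact: measurable_cst.
elim: (index_enum _) => [|j s IH].
  by under eq_fun do rewrite big_nil; exact: measurable_cst.
case: (boolP (j != m)) => jm; last by under eq_fun do rewrite big_cons (negPf jm).
under eq_fun do rewrite big_cons jm.
by apply: measurable_maxr => //; exact: measurable_post.
Qed.

Lemma dmeas_last_dec l n : dmeas (fun w => dec l w n).
Proof.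
elim: n => [|n IH].
  move=> o; have [e|e] := eqVneq o None.
    by rewrite (_ : _ @^-1` _ = setT)//; apply/seteqP; split => w //= _; rewrite e.
  by rewrite (_ : _ @^-1` _ = set0)//; apply/seteqP; split => w //= /esym/eqP; rewrite (negPf e).
apply: (dmeas_select (h := fun b w => if b then Some (istar d0 f l (H l w n.+1)) else dec l w n)).
  exact: dmeas_local_ok.
by case => //; apply: (dmeas_comp (@Some _) (g := fun w => istar d0 f l (H l w n.+1))); exact: dmeas_istar.
Qed.

Lemma dmeas_stopped n : dmeas (fun w => stop w n).
Proof.
pose g w := [ffun l => dec l w n].
pose h (o : {ffun 'I_L -> option 'I_M}) := [exists m, [forall l, o l == Some m]].
rewrite (_ : (fun w => _) = h \o g).
  by apply/dmeas_comp/dmeas_ffun => l; exact: dmeas_last_dec.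
apply/funext => w; rewrite /h /g /= /stopped; apply: eq_existsb => m.
by apply: eq_forallb => l; rewrite ffunE.
Qed.

Lemma Nstop_SomeP w n : N w = Some n <-> stop w n /\ forall k, (k < n)%N -> ~~ stop w k.
Proof.
rewrite /Nstop; case: pselect => [h|h]; last first.
  by split => // -[sn _]; exfalso; apply: h; exists n.
case: ex_minnP => m sm hm; split => [[<-]|[sn hn]].
  by split => // k km; apply/negP => /hm; rewrite leqNgt km.
congr Some; apply/eqP; rewrite eqn_leq hm//= leqNgt; apply/negP => mn.
by have := hn _ mn; rewrite sm.
Qed.

Lemma Nstop_NoneP w : N w = None <-> forall n, ~~ stop w n.
Proof.
rewrite /Nstop; case: pselect => [h|h]; split => //.
  by move=> hn; exfalso; case: (h) => n sn; have := hn n; rewrite sn.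
by move=> _ n; apply/negP => sn; apply: h; exists n.
Qed.

Lemma dmeas_Nstop : dmeas N.
Proof.
have mS n : measurable [set w | stop w n] by have := dmeas_stopped n true.
have mC n : measurable [set w | ~~ stop w n].
  rewrite (_ : [set w | _] = ~` [set w | stop w n]); first exact: measurableC.
  by apply/seteqP; split => w /= /negP.
case => [n|].
  rewrite (_ : _ @^-1` _ = [set w | stop w n] `&` \big[setI/setT]_(k < n) [set w | ~~ stop w k]).
    by apply: measurableI => //; exact: bigsetI_measurable.
  apply/seteqP; split => w /=.
    move=> /Nstop_SomeP[sn hn]; split => //; apply/bigsetI_seqP => k _; exact: hn.
  move=> [sn /bigsetI_seqP hn]; apply/Nstop_SomeP; split => // k kn.
  exact: (hn (Ordinal kn) (mem_index_enum _)).
rewrite (_ : _ @^-1` _ = \bigcap_n [set w | ~~ stop w n]); first exact: bigcapT_measurable.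
apply/seteqP; split => w /=; first by move=> /Nstop_NoneP h n _ /=.
by move=> h; apply/Nstop_NoneP => n; exact: h.
Qed.

Lemma measurable_Nstop_fun (h : option nat -> \bar R) : measurable_fun setT (h \o N).
Proof.
move=> _ B mB; rewrite setTI.
rewrite (_ : _ @^-1` _ = \bigcup_n [set w | N w = Some n /\ B (h (Some n))]
   `|` [set w | N w = None /\ B (h None)]).
  have mA o : measurable [set w | N w = o /\ B (h o)].
    have [Bo|nBo] := pselect (B (h o)).
      rewrite (_ : [set w | _] = N @^-1` [set o]); first exact: dmeas_Nstop.
      by apply/seteqP; split => w /= => [[]|].
    by rewrite (_ : [set w | _] = set0)//; apply/seteqP; split => w //= [].
  by apply: measurableU => //; exact: bigcupT_measurable.
apply/seteqP; split => w /=.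
  by case E : (N w) => [n|] Bw; [left; exists n|right].
by case => [[n _ [/= -> //]]|[-> //]].
Qed.

Lemma measurable_decides j : measurable (decides d0 f Q rh c Y U j).
Proof.
rewrite (_ : decides _ _ _ _ _ _ _ _ = \bigcup_n (N @^-1` [set Some n] `&`
    \big[setI/setT]_(l < L) (fun w => dec l w n) @^-1` [set Some j])).
  apply: bigcupT_measurable => n; apply: measurableI; first exact: dmeas_Nstop.
  by apply: bigsetI_measurable => l _; exact: dmeas_last_dec.
apply/seteqP; split => w /=.
  by move=> [n [Nn hn]]; exists n => //; split => //; apply/bigsetI_seqP => l _; exact: hn.
move=> [n _ [Nn /bigsetI_seqP hn]]; exists n; split => // l.
exact: (hn l (mem_index_enum _)).
Qed.

Lemma last_dec_SomeP l w n j : dec l w n = Some j ->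
  exists k, istar d0 f l (H l w k) = j /\ local_ok d0 f rh c l (H l w k).
Proof.
elim: n => [//|n IH]; rewrite /last_dec -/last_dec.
by case: ifPn => // ok [<-]; exists n.+1.
Qed.

(** The maximum in [local_ok] ranges over [i] too, since [i != j], and the common normalization
    cancels. *)
Lemma local_ok_LR l k w j : j != i -> lk l i k w != 0 -> local_ok d0 f rh c l (H l w k) ->
  istar d0 f l (H l w k) = j -> expR (rh l j * `|ln c|) <= LR l j k w.
Proof.
move=> ji h + e; rewrite /local_ok e => ok.
have lki : 0 < lk l i k w by rewrite lt_def h (lk_ge0 Q d0 Y U dens).
have S0 : 0 < \sum_m lk l m k w.
  rewrite (bigD1 i)//=; apply: ltr_pwDl => //; apply: sumr_ge0 => m _.
  exact: (lk_ge0 Q d0 Y U dens).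
rewrite ler_pdivlMr//.
have : expR (rh l j * `|ln c|) * post f l (H l w k) i <= post f l (H l w k) j.
  apply: le_trans ok; rewrite ler_wpM2l ?expR_ge0//.
  by apply: (le_bigmax_cond 0 (fun m => post f l (H l w k) m)); rewrite eq_sym.
by rewrite /post mulrA ler_pM2r// invr_gt0.
Qed.

(** The induction also carries that the intersection depends only on the sensors in [s], which makes
    it independent of the next one. *)
Lemma sensors_indep_le (s : seq 'I_L) (A : 'I_L -> set Om) (p : 'I_L -> R) : uniq s ->
  (forall l, src_sigma Y U (sensor l) (A l)) -> (forall l, P (A l) <= (p l)%:E)%E ->
  (P (\big[setI/setT]_(l <- s) A l) <= (\prod_(l <- s) p l)%:E)%E.
Proof.
move=> us sA hA.
suff [] : src_sigma Y U [set x | x.1.2 \in s] (\big[setI/setT]_(l <- s) A l) /\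
  (P (\big[setI/setT]_(l <- s) A l) <= (\prod_(l <- s) p l)%:E)%E by [].
elim: s us => [|l s IH] /=.
  move=> _; rewrite !big_nil probability_setT; split => //.
  exact: (@measurableT _ (src_sigmaType Y U [set x | x.1.2 \in [::]])).
move=> /andP[ls /IH[sB PB]]; rewrite !big_cons; split.
  apply: (@measurableI _ (src_sigmaType Y U [set x | x.1.2 \in l :: s])).
    by apply: sig_sub (sA l) => x /= ->; rewrite mem_head.
  by apply: sig_sub sB => x /=; rewrite inE => ->; rewrite orbT.
rewrite (sig_indep sk (K := sensor l) (K' := [set x | x.1.2 \in s]))//; last first.
  by move=> x /= -> h; rewrite h in ls.
by rewrite EFinM; apply: lee_pmul.
Qed.

(** A decision for [j] forces every sensor to cross its own level; by independence the bounds
    multiply, and the exponents [rh l j] sum to one, leaving [c]. *)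
Lemma decides_wrong_le j : j != i -> 0 < c -> c < 1 -> \sum_(l < L) rh l j = 1 ->
  exists A, [/\ measurable A, (P A <= c%:E)%E & decides d0 f Q rh c Y U j `<=`
     (\bigcup_l \bigcup_n [set w | lk l i n w = 0]) `|` A].
Proof.
move=> ji c0 c1 srho.
pose x l := expR (rh l j * `|ln c|).
pose A l := [set w | exists n, x l <= LR l j n w].
have sA l : src_sigma Y U (sensor l) (A l) by exact: sig_LR_reach.
exists (\big[setI/setT]_(l < L) A l); split.
- by apply: bigsetI_measurable => l _; exact: (sig_measurable sk (sA l)).
- apply: (@le_trans _ _ (\prod_(l < L) (x l)^-1)%:E).
    apply: sensors_indep_le => //; first exact: index_enum_uniq.
    by move=> l; apply: (LR_ville d0 dens pmfQ sk); exact: expR_gt0.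
  under eq_bigr do rewrite /x -expRN.
  rewrite -expR_sum sumrN -mulr_suml srho mul1r.
  by rewrite ltr0_norm ?ln_lt0 ?c0// opprK lnK.
- move=> w [n [Nn hn]].
  have [h|h] := pselect ((\bigcup_l \bigcup_n [set w | lk l i n w = 0]) w); [by left|right].
  apply/bigsetI_seqP => l _.
  have [k [ik ok]] := last_dec_SomeP (hn l).
  exists k; apply: local_ok_LR ok ik => //.
  by apply/eqP => lk0; apply: h; exists l => //; exists k.
Qed.

Lemma not_decides_sub : (0 < L)%N -> ~` decides d0 f Q rh c Y U i `<=`
  [set w | N w = None] `|` \bigcup_(j in [set j | j != i]) decides d0 f Q rh c Y U j.
Proof.
move=> hL w nd; case E : (N w) => [n|]; [right|by left].
have [/existsP[j /forallP hj] _] := (Nstop_SomeP w n).1 E.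
have Dj : decides d0 f Q rh c Y U j w by exists n; split => // l; exact/eqP/hj.
by exists j => //=; apply/eqP => ji; apply: nd; rewrite -ji.
Qed.

(** Union bound over the [M - 1] wrong hypotheses, plus two null events: never stopping and a
    vanishing true likelihood. *)
Lemma error_probability : (0 < L)%N -> 0 < c -> c < 1 ->
  (forall j, \sum_(l < L) rh l j = 1) -> P [set w | N w = None] = 0%E ->
  (P (~` decides d0 f Q rh c Y U i) <= ((M - 1)%:R * c)%:E)%E.
Proof.
move=> hL c0 c1 srho PN.
have /choice[A hA] : forall j, exists A, j != i -> [/\ measurable A, (P A <= c%:E)%E &
    decides d0 f Q rh c Y U j `<=` (\bigcup_l \bigcup_n [set w | lk l i n w = 0]) `|` A].
  move=> j; have [->|ji] := eqVneq j i; first by exists set0.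
  by have [B hB] := decides_wrong_le ji c0 c1 (srho j); exists B.
have : P.-negligible ([set w | N w = None] `|` \bigcup_l \bigcup_n [set w | lk l i n w = 0]).
  apply: negligibleU.
    by exists [set w | N w = None]; split => //; exact: (dmeas_Nstop None).
  rewrite (_ : \bigcup_l _ = \big[setU/set0]_(l < L) \bigcup_n [set w | lk l i n w = 0]); last first.
    by rewrite -bigcup_seq; apply/seteqP; split => w [l _ h]; exists l => //=; rewrite mem_index_enum.
  elim/big_ind: _ => //; [exact: negligible_set0|by move=> B C; exact: negligibleU|].
  by move=> l _; apply: negligible_bigcup => n; exact: (lk_eq0_negligible Q d0 dens sk).
move=> [Z [mZ Z0 hZ]].
have mA : measurable (\big[setU/set0]_(j | j != i) A j).
  by apply: bigsetU_measurable => j /hA[].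
apply: (@le_trans _ _ (P (Z `|` \big[setU/set0]_(j | j != i) A j))).
  apply: le_measure; rewrite ?inE.
  - exact/measurableC/measurable_decides.
  - exact: measurableU.
  - move=> w /(not_decides_sub hL) [h|[j /= ji Dj]]; first by left; apply: hZ; left.
    have [_ _ /(_ w Dj) [h|h]] := hA j ji; first by left; apply: hZ; right.
    by right; rewrite -bigcup_seq_cond; exists j; rewrite //= mem_index_enum.
apply: (@le_trans _ _ (P Z + P (\big[setU/set0]_(j | j != i) A j))%E); first exact: measureU2.
rewrite [X in (X + _)%E](_ : _ = 0%E)// add0e.
apply: (@le_trans _ _ (\sum_(j | j != i) P (A j))%E).
  by apply: measure_bigsetU_le => j /hA[].
apply: (@le_trans _ _ (\sum_(j : 'I_M | j != i) c%:E)%E).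
  by apply: lee_sum => j /hA[].
rewrite sumEFin lee_fin sumr_const -[leLHS]mulr_natl ler_wpM2r ?(ltW c0)//.
by rewrite (eq_card (B := predC1 i))// cardC1 card_ord subn1.
Qed.

End decision.

(** * Moments of the stopping time *)

(** If [p] were positive, [(1 + x) * expR (- x) <= 1] would push the exponential bound below [p] at
    an index beyond [K / (p * b)]. *)
Lemma exp_small_lbound {R : realType} (a : nat -> \bar R) (p : R) (n0 : nat) :
  exp_small a -> (forall n, (n0 <= n)%N -> (p%:E <= a n)%E) -> p <= 0.
Proof.
move=> [K [b [K0 b0 h]]] hp; rewrite leNgt; apply/negP => p0.
have [n hn] : exists n : nat, K / (p * b) < n%:R.
  exists (Num.Def.truncn (K / (p * b))).+1; exact: truncnS_gt.
rewrite ltr_pdivrMr ?mulr_gt0// in hn.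
pose m := maxn n0 n.
have := le_trans (hp m (leq_maxl _ _)) (h m); rewrite lee_fin => h1.
have h2 : (1 + b * m%:R) * expR (- (b * m%:R)) <= 1.
  have e : expR (b * m%:R) * expR (- (b * m%:R)) = 1 by rewrite -expRD subrr expR0.
  by rewrite -[leRHS]e ler_wpM2r ?expR_ge0// expR_ge1Dx.
have nm : (n%:R : R) <= m%:R by rewrite ler_nat leq_maxr.
have h3 : K < m%:R * (p * b) by apply: (lt_le_trans hn); rewrite ler_wpM2r// mulr_ge0// ltW.
have e0 := expR_gt0 (- (b * m%:R)).
have h4 : p * (1 + b * m%:R) <= K.
  apply: (@le_trans _ _ (K * expR (- (b * m%:R)) * (1 + b * m%:R))).
    by rewrite ler_wpM2r// addr_ge0// mulr_ge0// ltW.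
  by rewrite -mulrA [X in _ * X]mulrC -[leRHS]mulr1 ler_wpM2l.
by move: h3 h4; nra.
Qed.

Section moments.
Context {R : realType} {L M : nat} {dY} {Yt : measurableType dY} (mu : {measure set Yt -> \bar R}).
Variables (f : 'I_L -> 'I_M -> 'I_M -> Yt -> R) (Q : 'I_L -> 'I_M -> 'I_M -> R) (d0 : 'I_M).
Context {dO} {Om : measurableType dO} (P : probability Om R).
Variables (Y : nat -> 'I_L -> 'I_M -> Om -> Yt) (U : nat -> 'I_L -> Om -> R) (i : 'I_M).
Hypotheses (hL : (0 < L)%N) (hM : (1 < M)%N).
Hypothesis dens : forall l u i, is_density mu (f l u i).
Hypothesis klfin : forall l u i j, (KL mu (f l u i) (f l u j) < +oo)%E.
Hypothesis klpos : forall l (i j : 'I_M), i != j -> exists u, (0 < KL mu (f l u i) (f l u j))%E.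
Hypothesis secfin : forall l u i j,
  (\int[mu]_y (f l u i y * (ln (f l u i y / f l u j y)) ^+ 2)%:E < +oo)%E.
Hypothesis optQ : forall l i, is_pmf (Q l i) /\
  forall q : 'I_M -> R, is_pmf q -> Jobj mu f l i q <= Jobj mu f l i (Q l i).
Hypothesis sk : skeleton P mu (fun l u => f l u i) Y U.

Local Notation rh := (rho mu f).
Local Notation v l := (vval mu f l i).
Local Notation I := (Iinfo mu f i).
Local Notation N c := (Nstop d0 f Q rh c Y U).
Local Notation stop c := (stopped d0 f Q rh c Y U).
Local Notation lk := (lk f Q d0 Y U).
Local Notation LR := (LR f Q d0 Y U i).

Let v0 l m : 0 < vval mu f l m.
Proof. exact: vval_gt0. Qed.

Let I0 : 0 < I.
Proof. exact: Iinfo_gt0. Qed.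

(** Does not involve [c], so constants derived from its probabilities are uniform in [c]. *)
Definition bad_event (eta : R) (n : nat) : set Om :=
  \big[setU/set0]_(x : 'I_L * 'I_M | x.2 != i)
    fail_event f Q d0 Y U i x.1 (vval mu f x.1) x.2 eta n.

Lemma measurable_bad_event eta n : measurable (bad_event eta n).
Proof.
apply: bigsetU_measurable => x _; exact: (measurable_fail_event Q d0 dens sk).
Qed.

Lemma bad_event_exp_small eta : 0 < eta -> eta < 1 -> exp_small (fun n => P (bad_event eta n)).
Proof.
move=> eta0 eta1; have [C C0 rate] := chernoff_rate dens klfin secfin optQ.
apply: exp_small_le (exp_small_sum (index_enum _) (p := fun x : 'I_L * 'I_M => x.2 != i)
  (F := fun x n => P (fail_event f Q d0 Y U i x.1 (vval mu f x.1) x.2 eta n)) _).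
  move=> n; apply: measure_bigsetU_le => x _.
  exact: (measurable_fail_event Q d0 dens sk).
move=> x xi; apply: (@fail_event_exp_small _ _ _ _ _ mu f Q d0 _ _ P Y U i dens) C0 _ _ _ _ xi eta0 eta1 => //.
  by move=> l m; case: (optQ l m).
by move=> m j t jm t0 t2; exact: rate.
Qed.

(** Since [rh l i * |ln c| = v l * (|ln c| / I)], thresholds are proportional to the drifts and all
    sensors need the same time; outside the bad event each of them declares [i] at time [n]
    itself. *)
Lemma stopped_outside c eta n w : 0 < c -> c < 1 -> (0 < n)%N ->
  `|ln c| / I <= eta * n.+1%:R -> ~ bad_event eta n w -> stop c w n.
Proof.
move=> c0 c1 n0 hc nb; apply/existsP; exists i; apply/forallP => l; apply/eqP.
have a0 : 0 < `|ln c| by rewrite normr_gt0 lt_eqF// ln_lt0// c0.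
have good j : j != i -> lk l i n w != 0 /\ LR l j n w <= expR (- (v l * (`|ln c| / I))).
  move=> ji; have nf : ~ fail_event f Q d0 Y U i l (vval mu f l) j eta n w.
    move=> h; apply: nb; rewrite /bad_event -bigcup_seq_cond.
    by exists (l, j); rewrite //= mem_index_enum.
  split; first by apply/eqP => h; apply: nf; left.
  rewrite leNgt; apply/negP => h; apply: nf; right => /=.
  apply: le_lt_trans h; rewrite ler_expR lerN2.
  have -> : eta * v l * n.+1%:R = v l * (eta * n.+1%:R) by ring.
  by rewrite ler_pM2l.
have [j0 j0i] := exists_other hM i.
have [lkn0 _] := good _ j0i.
have lki : 0 < lk l i n w by rewrite lt_def lkn0 (lk_ge0 Q d0 Y U dens).
have S0 : 0 < \sum_m lk l m n w.
  rewrite (bigD1 i)//=; apply: ltr_pwDl => //; apply: sumr_ge0 => m _.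
  exact: (lk_ge0 Q d0 Y U dens).
have key j : j != i -> post f l (hist d0 f Q Y U l w n) j <=
    expR (- (v l * (`|ln c| / I))) * post f l (hist d0 f Q Y U l w n) i.
  move=> /good[_]; rewrite ler_pdivrMr// => h.
  by rewrite /post mulrA ler_pM2r// invr_gt0.
have p0 : 0 < post f l (hist d0 f Q Y U l w n) i by rewrite divr_gt0.
have va : 0 < v l * (`|ln c| / I) by rewrite mulr_gt0// divr_gt0.
have ei : istar d0 f l (hist d0 f Q Y U l w n) = i.
  apply: argmaxI_eq => j /key h; apply: (le_lt_trans h).
  by rewrite -[ltRHS]mul1r ltr_pM2r// -expR0 ltr_expR oppr_lt0.
have ok : local_ok d0 f rh c l (hist d0 f Q Y U l w n).
  rewrite /local_ok ei -ler_pdivlMl ?expR_gt0// -expRN.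
  have -> : rh l i * `|ln c| = v l * (`|ln c| / I) by rewrite /rho mulrAC mulrA.
  by apply: bigmax_le => [|j ji]; [rewrite mulr_ge0 ?expR_ge0 ?ltW|exact: key].
(* [last_dec] at time [0] is always [None], whence the condition [0 < n]. *)
case: n n0 ok ei {hc nb good lkn0 lki S0 key p0} => // n _ ok ei.
by rewrite /last_dec -/last_dec ok ei.
Qed.

(** Never stopping is contained in every bad event of large index; [2^-1] is an arbitrary choice of
    [eta]. *)
Lemma Nstop_None_eq0 c : 0 < c -> c < 1 -> P [set w | N c w = None] = 0%E.
Proof.
move=> c0 c1.
have mN : measurable [set w | N c w = None] by exact: (dmeas_Nstop Q d0 dens sk rh c None).
have fin : P [set w | N c w = None] \is a fin_num by exact: fin_num_measure.
have h2 : (0 : R) < 2^-1 by rewrite invr_gt0.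
have h1 : (2^-1 : R) < 1 by lra.
suff : fine (P [set w | N c w = None]) <= 0.
  move=> h; apply/eqP; rewrite eq_le measure_ge0 andbT -(fineK fin).
  by rewrite lee_fin.
pose A := `|ln c| / I / 2^-1.
apply: (exp_small_lbound (n0 := (Num.Def.truncn A).+1) (bad_event_exp_small h2 h1)) => n hn.
rewrite fineK//; apply: le_measure; rewrite ?inE//; first exact: measurable_bad_event.
move=> w /= /Nstop_NoneP /(_ n) ns; apply: contrapT => nb; move/negP: ns; apply.
apply: stopped_outside nb => //; first exact: leq_trans hn.
have : A < n.+1%:R.
  apply: lt_le_trans (truncnS_gt A) _.
  by rewrite ler_nat; apply: leq_trans hn _.
by rewrite /A ltr_pdivrMr// => h; rewrite ltW// [ltRHS]mulrC.
Qed.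

(** If [N] exceeds [A], the time just before it is bad, and the term of the series at that time is
    exactly the [r]-th power of [N]. *)
Lemma NEpow_le c eta (r A : R) w : 0 < c -> c < 1 -> 0 < r -> 1 <= A ->
  `|ln c| / I <= eta * A -> 0 < eta -> N c w <> None ->
  (NEpow r (N c w) <=
     (A `^ r)%:E + \sum_(n <oo) (n.+1%:R `^ r)%:E * (\1_(bad_event eta n) w)%:E)%E.
Proof.
move=> c0 c1 r0 A1 hA eta0; case E : (N c w) => [n|//] _ /=.
have ser0 : (forall n, 0 <= (n.+1%:R `^ r)%:E * (\1_(bad_event eta n) w)%:E :> \bar R)%E.
  by move=> k; rewrite mule_ge0// lee_fin ?powR_ge0// indicE.
have [nA|An] := leP n%:R A.
  apply: (@le_trans _ _ (A `^ r)%:E).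
    by rewrite lee_fin ge0_ler_powR ?nnegrE// ltW// (lt_le_trans ltr01).
  by rewrite leeDl//; apply: nneseries_ge0 => k _ _; exact: ser0.
(* [1 <= A < n] gives [n >= 2], so the preceding time is positive, as [stopped_outside] requires. *)
have [k nk] : exists k, n = k.+2.
  have := le_lt_trans A1 An; rewrite ltr1n.
  by case: n {E An} => [//|[//|k]] _; exists k.
have [_ hmin] := (Nstop_SomeP f Q d0 Y U rh c w n).1 E.
have bad : bad_event eta k.+1 w.
  apply: contrapT => nb; have := hmin k.+1; rewrite nk ltnSn => /(_ isT)/negP; apply.
  apply: stopped_outside nb => //; apply: (le_trans hA).
  by rewrite ler_pM2l// ltW// -nk.
apply: (@le_trans _ _ (\sum_(n <oo) (n.+1%:R `^ r)%:E * (\1_(bad_event eta n) w)%:E)%E).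
  apply: le_trans (nneseries_lim_ge k.+2 _); last by move=> m _ _; exact: ser0.
  rewrite big_nat_recr//= indicE mem_set// mule1 nk leeDr//.
  by apply: sume_ge0 => m _; exact: ser0.
by rewrite leeDr// lee_fin powR_ge0.
Qed.

(** [K] is the integral of the series in [NEpow_le]: finite because bad events are exponentially
    small, and chosen before [c]. *)
Lemma integral_NEpow_le (eta r : R) : 0 < eta -> eta < 1 -> 0 < r ->
  exists2 K : R, 0 <= K & forall c A, 0 < c -> c < 1 -> 1 <= A -> `|ln c| / I <= eta * A ->
    (\int[P]_w NEpow r (N c w) <= (A `^ r + K)%:E)%E.
Proof.
move=> eta0 eta1 r0.
pose S := (\sum_(n <oo) (n.+1%:R `^ r)%:E * P (bad_event eta n))%E.
have S0 : (0 <= S)%E.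
  by apply: nneseries_ge0 => n _ _; rewrite mule_ge0// lee_fin powR_ge0.
have Sfin : S \is a fin_num.
  rewrite ge0_fin_numE//; apply: exp_small_powR_summable => //.
  exact: bad_event_exp_small.
exists (fine S); first exact: fine_ge0.
move=> c A c0 c1 A1 hA.
pose F n w := ((n.+1%:R `^ r)%:E * (\1_(bad_event eta n) w)%:E : \bar R)%E.
have mF n : measurable_fun setT (F n).
  apply/measurable_EFinP; apply: measurable_funM => //.
  by apply: measurable_indic; exact: measurable_bad_event.
have F0 n w : (0 <= F n w)%E by rewrite mule_ge0// lee_fin ?powR_ge0// indicE.
have ser0 w : (0 <= \sum_(n <oo) F n w)%E by apply: nneseries_ge0.
have mser : measurable_fun setT (fun w => \sum_(n <oo) F n w)%E.
  by apply: ge0_emeasurable_sum => // n w _ _; exact: F0.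
have A0 : (0 <= (A `^ r)%:E)%E by rewrite lee_fin powR_ge0.
apply: (@le_trans _ _ (\int[P]_w ((A `^ r)%:E + \sum_(n <oo) F n w))%E).
  apply: ae_ge0_le_integral => //.
  - by move=> w _; case: (N c w) => [n|] /=; rewrite ?leey// lee_fin powR_ge0.
  - exact: (measurable_Nstop_fun Q d0 dens sk rh c (NEpow r)).
  - by move=> w _; rewrite adde_ge0.
  - by apply: emeasurable_funD.
  (* The pathwise bound is only claimed where [N] is finite, hence the almost-everywhere
     comparison. *)
  - exists [set w | N c w = None]; split.
    + exact: (dmeas_Nstop Q d0 dens sk rh c None).
    + exact: Nstop_None_eq0.
    + move=> w /= nh; apply: contrapT => hN; apply: nh => _.
      exact: NEpow_le.
have EA : (\int[P]_w (A `^ r)%:E = (A `^ r)%:E)%E.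
  rewrite integral_cst// [X in (_ * X)%E](_ : _ = 1%E) ?mule1//.
  exact: probability_setT.
rewrite ge0_integralD// EA integral_nneseries//.
rewrite EFinD fineK//; apply: leeD => //.
rewrite le_eqVlt; apply/orP; left; apply/eqP; apply: eq_eseriesr => n _.
rewrite /F ge0_integralZl//.
- by rewrite integral_indic ?setIT//; exact: measurable_bad_event.
- by apply/measurable_EFinP; apply: measurable_indic; exact: measurable_bad_event.
Qed.

Lemma ln_large (B : R) : exists2 del : R, 0 < del &
  forall c, 0 < c -> c < 1 -> c < del -> B <= `|ln c|.
Proof.
exists (expR (- B)); first exact: expR_gt0.
move=> c c0 c1 cd; rewrite ltr0_norm ?ln_lt0 ?c0// lerNr ltW//.
by rewrite -ltr_expR lnK ?posrE.
Qed.

Lemma moment_asymptotics (r eps : R) : 1 <= r -> 0 < eps -> exists2 del : R, 0 < del &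
  forall c, 0 < c < 1 -> c < del ->
    (\int[P]_w NEpow r (N c w) <= (((1 + eps) * (`|ln c| / I)) `^ r)%:E)%E.
Proof.
move=> r1 eps0; have r0 : 0 < r by lra.
(* [g] takes half of [eps] to slow the drift, with [eta = g^-1]; the remaining factor [k] absorbs
   the additive constant [K]. *)
pose g := 1 + eps / 2; have g1 : 1 < g by rewrite /g; lra.
have g0 : 0 < g by lra.
have [K K0 hK] := @integral_NEpow_le g^-1 r (ltac:(by rewrite invr_gt0)) (ltac:(by rewrite invf_lt1)) r0.
pose k := (1 + eps) / g; have k1 : 1 < k by rewrite /k ltr_pdivlMr// mul1r /g; lra.
(* Once [A] is above [B], both [1 <= A] and [K <= A * (k - 1)] hold. *)
pose B := Num.max 1 (K / (k - 1)).
have [del del0 hdel] := ln_large (B * I / g).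
exists del => // c /andP[c0 c1] cd; have hc := hdel c c0 c1 cd.
pose A := g * (`|ln c| / I).
have AB : B <= A.
  by rewrite /A mulrA ler_pdivlMr// [leRHS]mulrC -ler_pdivrMr.
have A1 : 1 <= A by apply: le_trans AB; rewrite /B le_max lexx.
have AK : K <= A * (k - 1).
  by rewrite -ler_pdivrMr ?subr_gt0//; apply: le_trans AB; rewrite /B le_max lexx orbT.
apply: le_trans (hK c A c0 c1 A1 _) _; first by rewrite /A mulKf// gt_eqF.
have -> : (1 + eps) * (`|ln c| / I) = A * k.
  by rewrite /A /k; field; rewrite !gt_eqF.
rewrite lee_fin powRM; [|lra|lra].
(* As [r], [A] and [k] are at least one, powers only increase, so
   [A ^ r + K <= A ^ r * k <= (A * k) ^ r]. *)
have Ar : A <= A `^ r by rewrite -[leLHS]powRr1 ?ler_powR//; lra.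
have kr : k <= k `^ r by rewrite -[leLHS]powRr1 ?ler_powR//; lra.
have Ar0 : 0 <= A `^ r by exact: powR_ge0.
apply: (@le_trans _ _ (A `^ r * k)); last by rewrite ler_wpM2l.
have : A * (k - 1) <= A `^ r * (k - 1) by rewrite ler_wpM2r// subr_ge0 ltW.
lra.
Qed.

End moments.

(** * Assembly of the error, mean, risk and moment bounds *)

Unset Implicit Arguments.
Set Strict Implicit.

Theorem theorem1 (R : realType) (L M : nat) (hL : (0 < L)%N) (hM : (1 < M)%N)
  (dY : measure_display) (Yt : measurableType dY) (mu : {measure set Yt -> \bar R})
  (f : 'I_L -> 'I_M -> 'I_M -> Yt -> R)      (* f l u i = p^u_{i,l} *)
  (Q : 'I_L -> 'I_M -> 'I_M -> R)            (* Q l i = Q^l_i *)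
  (om : 'I_M -> R)                           (* costs of wrong decision *)
  (dO : measure_display) (Om : measurableType dO)
  (P : 'I_M -> probability Om R)             (* P i : law when h_i is true *)
  (Y : nat -> 'I_L -> 'I_M -> Om -> Yt) (U : nat -> 'I_L -> Om -> R) :
  (* densities *)
  (forall l u i, is_density mu (f l u i)) ->
  (* standing assumptions *)
  (forall l u i j, (KL mu (f l u i) (f l u j) < +oo)%E) ->
  (forall l (i j : 'I_M), i != j -> exists u, (0 < KL mu (f l u i) (f l u j))%E) ->
  (forall l u i j,
     (\int[mu]_y (f l u i y * (ln (f l u i y / f l u j y)) ^+ 2)%:E < +oo)%E) ->
  (* Q^l_i is a maximizer of q |-> min_{j<>i} sum_u q(u) D(p^u_{i,l}||p^u_{j,l}) *)
  (forall l i, is_pmf (Q l i) /\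
     forall q : 'I_M -> R, is_pmf q -> Jobj mu f l i q <= Jobj mu f l i (Q l i)) ->
  (forall i, 0 < om i) ->
  (* under P i, the observations/randomizations have the model's law *)
  (forall i, skeleton (P i) mu (fun l u => f l u i) Y U) ->
  let d0 := ord0_of hM in
  let rh := rho mu f in
  let N c := Nstop d0 f Q rh c Y U in
  let err c i := ~` decides d0 f Q rh c Y U i in
  (* (i) *)
  (forall c, 0 < c < 1 -> forall i,
     (P i (err c i) <= (Num.min ((M - 1)%:R * c) 1)%:E)%E)
  /\
  (* (ii) *)
  (forall i (eps : R), 0 < eps -> exists2 del : R, 0 < del &
     forall c, 0 < c < 1 -> c < del ->
       (\int[P i]_w NE (N c w) <= ((1 + eps) * (`|ln c| / Iinfo mu f i))%:E)%E)
  /\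
  (* (iii) *)
  (forall i (eps : R), 0 < eps -> exists2 del : R, 0 < del &
     forall c, 0 < c < 1 -> c < del ->
       (c%:E * \int[P i]_w NE (N c w) + (om i)%:E * P i (err c i)
          <= ((1 + eps) * (c * `|ln c| / Iinfo mu f i))%:E)%E)
  /\
  (* (iv) *)
  (forall r : R, 2 <= r ->
     (forall l u i j,
        (\int[mu]_y (f l u i y * powR `|ln (f l u i y / f l u j y)| r)%:E < +oo)%E) ->
     forall i (eps : R), 0 < eps -> exists2 del : R, 0 < del &
       forall c, 0 < c < 1 -> c < del ->
         (\int[P i]_w NEpow r (N c w)
            <= (powR ((1 + eps) * (`|ln c| / Iinfo mu f i)) r)%:E)%E).
Proof.
move=> dens klfin klpos secfin optQ om0 sk d0 rh N err.
have pmfQ l m : is_pmf (Q l m) by case: (optQ l m).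
have I0 i : 0 < Iinfo mu f i by exact: Iinfo_gt0.
have err_le c : 0 < c -> c < 1 -> forall i, (P i (err c i) <= ((M - 1)%:R * c)%:E)%E.
  move=> c0 c1 i; have srho j : \sum_(l < L) rho mu f l j = 1 by exact: sum_rho.
  apply: (error_probability dens pmfQ (sk i) hL c0 c1 srho).
  exact: (Nstop_None_eq0 d0 hL hM dens klfin klpos secfin optQ (sk i)).
have moment (r : R) : 1 <= r -> forall i (eps : R), 0 < eps -> exists2 del : R, 0 < del &
    forall c, 0 < c < 1 -> c < del ->
    (\int[P i]_w NEpow r (N c w) <= (powR ((1 + eps) * (`|ln c| / Iinfo mu f i)) r)%:E)%E.
  move=> r1 i eps eps0.
  exact: (moment_asymptotics d0 hL hM dens klfin klpos secfin optQ (sk i) r1 eps0).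
have mean i (eps : R) : 0 < eps -> exists2 del : R, 0 < del &
    forall c, 0 < c < 1 -> c < del ->
    (\int[P i]_w NE (N c w) <= ((1 + eps) * (`|ln c| / Iinfo mu f i))%:E)%E.
  move=> eps0; have [del del0 h] := moment 1 (lexx 1) i eps eps0.
  exists del => // c hc cd; have := h c hc cd.
  rewrite powRr1; last first.
    by rewrite mulr_ge0 ?divr_ge0 ?(ltW (I0 i))// addr_ge0// ltW.
  apply: le_trans; rewrite le_eqVlt; apply/orP; left; apply/eqP.
  by apply: eq_integral => w _; case: (N c w) => [n|] //=; rewrite powRr1.
split.
  move=> c /andP[c0 c1] i; rewrite EFin_min le_min err_le//=.
  apply: probability_le1; apply: measurableC.
  exact: (measurable_decides Q d0 dens (sk i)).
split; first exact: mean.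
split.
  move=> i eps eps0; have eps2 : 0 < eps / 2 by rewrite divr_gt0.
  have [del1 del10 h1] := mean i _ eps2.
  (* Beyond this value of [|ln c|] the error cost, at most [om i * (M - 1) * c], fits into the
     second half of [eps]. *)
  have [del2 del20 h2] := ln_large (om i * (M - 1)%:R * Iinfo mu f i / (eps / 2)).
  exists (Num.min del1 del2); first by rewrite lt_min del10.
  move=> c hc; rewrite lt_min => /andP[cd1 cd2]; have /andP[c0 c1] := hc.
  apply: (@le_trans _ _ (c%:E * ((1 + eps / 2) * (`|ln c| / Iinfo mu f i))%:E
      + (om i)%:E * ((M - 1)%:R * c)%:E)%E).
    apply: leeD; apply: lee_wpmul2l; rewrite ?lee_fin ?(ltW c0) ?(ltW (om0 i))//.
      exact: h1.
    exact: err_le.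
  rewrite -!EFinM -EFinD lee_fin.
  have hl : om i * (M - 1)%:R <= eps / 2 * (`|ln c| / Iinfo mu f i).
    rewrite mulrA ler_pdivlMr// [leRHS]mulrC -ler_pdivrMr//.
    exact: h2.
  have := ler_wpM2l (ltW c0) hl.
  rewrite -[c * `|ln c| / _]mulrA.
  set a := `|ln c| / _; set b := (M - 1)%:R; lra.
move=> r r2 _ i eps eps0; apply: moment => //; lra.
Qed.
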